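(* Let $d\geq 2$ be an integer, let $k\in\{\lceil d/2\rceil-1,\ldots,d-1\}$, let $M$ be a positive integer and let $q\in\mathbb{R}$. For every polytope $Q_M\subset\mathbb{R}^d$ with $Q_M\supset B_d$ and with at most $M$ $k$-dimensional faces, the following hold. (i) If $0<|q|\leq d$, then \[ \widetilde\Delta_q(B_d,Q_M)\geq\frac{3(1-e^{-1})}{4}\,\widetilde{V}_{|q|}(B_d)\,\min\left\{1,\ \frac{|q|}{6}\left(\frac{\omega_d}{4\kappa_{d-1}}\right)^{\frac{2}{d-1}}M^{-\frac{2}{d-1}}\right\}. \] (ii) If $|q|>d$, then \[ \widetilde\Delta_q(B_d,Q_M)\geq\frac{3(1-e^{-1})}{4}\,\kappa_d\,\min\left\{1,\ \frac{|q|}{6}\left(\frac{\omega_d}{4\kappa_{d-1}}\right)^{\frac{2}{d-1}}M^{-\frac{2}{d-1}}\right\}. \] (iii) If $q=0$, then \[ \widehat\Delta_0(B_d,Q_M)\geq\frac18\left(\frac{\omega_d}{4\kappa_{d-1}}\right)^{\frac{2}{d-1}}M^{-\frac{2}{d-1}}. \]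
   Context: $B_d$ is the Euclidean unit ball in $\mathbb{R}^d$ centered at the origin $o$, $\kappa_d=\operatorname{vol}_d(B_d)=\pi^{d/2}/\Gamma(\frac d2+1)$, and $\omega_d=\operatorname{vol}_{d-1}(\partial B_d)=d\kappa_d$. A polytope is the convex hull of finitely many points in $\mathbb{R}^d$ (in particular, it is bounded). $\sigma$ is the normalized (probability) surface area measure on the unit sphere $\mathbb{S}^{d-1}$. $\mathcal{K}_o^d$ is the class of convex bodies in $\mathbb{R}^d$ containing the origin in their interiors, and for $K\in\mathcal{K}_o^d$ the radial function is $\rho_K(u)=\sup\{\lambda\geq 0:\lambda u\in K\}$, $u\in\mathbb{S}^{d-1}$. For $q\in[0,d]$ set \[ \widetilde{V}_q(B_d):=\pi^{\frac q2}\,\frac{\Gamma(d+1)}{\Gamma(q+1)\Gamma(d-q+1)}\cdot\frac{\Gamma\left(\frac{d-q}{2}+1\right)}{\Gamma\left(\frac d2+1\right)}. \] For $q\in\mathbb{R}\setminus\{0\}$ set $c_1(d,q):=\widetilde{V}_{|q|}(B_d)$ if $0<|q|\leq d$ and $c_1(d,q):=\kappa_d$ if $|q|>d$. For $K,L\in\mathcal{K}_o^d$ and $q\neq 0$, the $q$th dual volume deviation is \[ \widetilde{\Delta}_q(K,L):=c_1(d,q)\int_{\mathbb{S}^{d-1}}|\rho_K(u)^q-\rho_L(u)^q|\,d\sigma(u). \] For $q=0$, set $\widehat{V}_0(K):=\int_{\mathbb{S}^{d-1}}\ln\rho_K(u)\,d\sigma(u)$ and define the $0$th dual volume deviation by \[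 \widehat{\Delta}_0(K,L):=\widehat{V}_0(K)+\widehat{V}_0(L)-2\widehat{V}_0(K\cap L). \] *)

(* Defs.v *)
From HB Require Import structures.
From mathcomp Require Import all_boot all_order all_algebra.
From mathcomp Require Import all_classical all_reals all_analysis.
From mathcomp Require Import measurable_realfun.

Set Implicit Arguments.
Unset Strict Implicit.
Unset Printing Implicit Defensive.

Import Order.TTheory GRing.Theory Num.Theory.
Import numFieldNormedType.Exports.

Local Open Scope classical_set_scope.
Local Open Scope ring_scope.

(* The library's norm `|x| on 'rV[R]_d is the max norm, hence [enorm]. *)
Definition dotmul {R : realType} {d : nat} (x y : 'rV[R]_d) : R :=
  \sum_(i < d) x ord0 i * y ord0 i.

Definition enorm {R : realType} {d : nat} (x : 'rV[R]_d) : R :=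
  Num.sqrt (dotmul x x).

Definition unit_ball (R : realType) (d : nat) : set 'rV[R]_d :=
  [set x | enorm x <= 1].

Definition unit_sphere (R : realType) (d : nat) : set 'rV[R]_d :=
  [set x | enorm x = 1].

Arguments unit_ball R d : clear implicits.
Arguments unit_sphere R d : clear implicits.

(* The product sigma-algebra, generated by the coordinate maps; it is the Borel
   sigma-algebra. *)
Section measurable_rV.
Context {R : realType} {d : nat}.

Definition coord_rV (i : 'I_d) (x : 'rV[R]_d) : R := x ord0 i.

Definition measurable_rV : set (set 'rV[R]_d) := g_sigma_preimage coord_rV.

Let measurable_rV0 : measurable_rV set0.
Proof. exact: sigma_algebra0. Qed.

Let measurable_rVC A : measurable_rV A -> measurable_rV (~` A).
Proof. exact: sigma_algebraC. Qed.

Let measurable_rV_bigcup (F : (set 'rV[R]_d)^nat) :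
  (forall i, measurable_rV (F i)) -> measurable_rV (\bigcup_i (F i)).
Proof. exact: sigma_algebra_bigcup. Qed.

HB.instance Definition _ := @isMeasurable.Build default_measure_display
  'rV[R]_d measurable_rV measurable_rV0 measurable_rVC measurable_rV_bigcup.

End measurable_rV.

Lemma measurable_coord_rV (R : realType) (d : nat) (i : 'I_d) :
  measurable_fun [set: 'rV[R]_d] (coord_rV i).
Proof.
move=> _ Y mY; rewrite setTI; apply: sub_sigma_algebra => /=.
rewrite -bigcup_seq/=; exists i => /=; first by rewrite mem_index_enum.
by exists Y => //; rewrite setTI.
Qed.

Lemma measurable_fun_rVP (R : realType) d1 (T1 : measurableType d1) (d : nat)
    (f : T1 -> 'rV[R]_d) :
  measurable_fun [set: T1] f <->
  forall i, measurable_fun [set: T1] (coord_rV i \o f).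
Proof.
split=> [mf i|mf].
  by apply: measurableT_comp => //; exact: measurable_coord_rV.
have : g_sigma_preimage (fun i => coord_rV i \o f) `<=` measurable.
  apply: smallest_sub; first exact: sigma_algebra_measurable.
  case: d => [|d] in f mf *; first by rewrite big_ord0.
  rewrite -bigcup_mkord_ord; apply: bigcup_sub => i Ii.
  by move=> A [B mB <-]; exact: mf.
rewrite g_sigma_preimage_comp => preS _ A mA.
by apply: preS; exists A.
Qed.

Section lebesgue_rV.
Context {R : realType}.

Definition rV_cons (n : nat) (p : R * 'rV[R]_n) : 'rV[R]_n.+1 :=
  \row_j if unlift ord0 j is Some i then p.2 ord0 i else p.1.

Definition rV_uncons (n : nat) (x : 'rV[R]_n.+1) : R * 'rV[R]_n :=
  (x ord0 ord0, \row_i x ord0 (lift ord0 i)).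

Lemma rV_consK n : cancel (@rV_cons n) (@rV_uncons n).
Proof.
case=> a x; rewrite /rV_cons /rV_uncons !mxE unlift_none /=; congr pair.
by apply/rowP => i; rewrite !mxE liftK.
Qed.

Lemma measurable_rV_cons n :
  measurable_fun [set: measurableTypeR R * 'rV[R]_n] (@rV_cons n).
Proof.
apply/measurable_fun_rVP => i; case: (unliftP ord0 i) => [j ->|->].
- rewrite (_ : _ \o _ = coord_rV j \o snd).
    by apply: measurableT_comp => //; exact: measurable_coord_rV.
  by apply/funext => p; rewrite /= /coord_rV /rV_cons mxE liftK.
- rewrite (_ : _ \o _ = fst); first exact: measurable_fst.
  by apply/funext => p; rewrite /= /coord_rV /rV_cons mxE unlift_none.
Qed.

Lemma measurable_rV_uncons n :
  @measurable_fun _ _ _ (measurableTypeR R * 'rV[R]_n)%type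
    [set: 'rV[R]_n.+1] (@rV_uncons n).
Proof.
apply: measurable_fun_pair; first exact: measurable_coord_rV.
apply/measurable_fun_rVP => i.
rewrite (_ : _ \o _ = coord_rV (lift ord0 i)).
  exact: measurable_coord_rV.
by apply/funext => x; rewrite /= /coord_rV mxE.
Qed.

Section lebesgue_rV_step.
Variables (n : nat) (mu : {sigma_finite_measure set 'rV[R]_n -> \bar R}).
Local Open Scope ereal_scope.

Definition lebesgue_rV_step (A : set 'rV[R]_n.+1) : \bar R :=
  (@lebesgue_measure R \x mu) (@rV_cons n @^-1` A).

Let step0 : lebesgue_rV_step set0 = 0.
Proof. by rewrite /lebesgue_rV_step preimage_set0 measure0. Qed.

Let step_ge0 A : 0 <= lebesgue_rV_step A.
Proof. exact: measure_ge0. Qed.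

Let step_sigma_additive : semi_sigma_additive lebesgue_rV_step.
Proof.
move=> F mF tF mUF; rewrite /lebesgue_rV_step preimage_bigcup.
apply: measure_semi_sigma_additive.
- by move=> n0; rewrite -[X in measurable X]setTI; exact: measurable_rV_cons.
- apply/trivIsetP => /= i j _ _ ij; rewrite -preimage_setI.
  by move/trivIsetP : tF => /(_ _ _ _ _ ij) ->//; rewrite preimage_set0.
- rewrite -preimage_bigcup -[X in measurable X]setTI.
  exact: measurable_rV_cons.
Qed.

HB.instance Definition _ := isMeasure.Build _ _ _ lebesgue_rV_step
  step0 step_ge0 step_sigma_additive.

Let step_sigma_finite : sigma_finite setT lebesgue_rV_step.
Proof.
have /sigma_finiteP[F [TF ndF Foo]] := sigma_finiteT (@lebesgue_measure R).
have /sigma_finiteP[G [TG ndG Goo]] := sigma_finiteT mu.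
exists (fun i => @rV_uncons n @^-1` (F i `*` G i)) => [|i].
  rewrite -preimage_bigcup (_ : \bigcup_i _ = setT) ?preimage_setT//.
  rewrite -setXTT TF TG predeqE => -[x y]; split.
    by move=> [i _ []/= ? ?]; split; exists i.
  move=> [/= [i _ Fix] [k _ Gky]]; exists (maxn i k) => //; split.
  - by move: x Fix; exact/subsetPset/ndF/leq_maxl.
  - by move: y Gky; exact/subsetPset/ndG/leq_maxr.
have [mFi Fioo] := Foo i; have [mGi Gioo] := Goo i.
have mFG : measurable (F i `*` G i) by exact: measurableX.
split.
  by rewrite -[X in measurable X]setTI; exact: measurable_rV_uncons.
rewrite /lebesgue_rV_step -comp_preimage (_ : _ \o _ = idfun) ?preimage_id.
  by rewrite product_measure1E// lte_mul_pinfty// ge0_fin_numE.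
by apply/funext => p /=; rewrite rV_consK.
Qed.

HB.instance Definition _ := Measure_isSigmaFinite.Build _ _ _ lebesgue_rV_step
  step_sigma_finite.

End lebesgue_rV_step.

Fixpoint lebesgue_rV (n : nat) : {sigma_finite_measure set 'rV[R]_n -> \bar R} :=
  match n with
  | 0 => \d_(0 : 'rV[R]_0)
  | n'.+1 => lebesgue_rV_step (lebesgue_rV n')
  end.

Lemma lebesgue_rV_box (n : nat) (A : 'I_n -> set R) :
  (forall i, measurable (A i)) ->
  lebesgue_rV n [set x | forall i, A i (x ord0 i)] =
  (\prod_(i < n) lebesgue_measure (A i))%E.
Proof.
have mbox m (B : 'I_m -> set R) : (forall i, measurable (B i)) ->
    measurable [set x : 'rV[R]_m | forall i, B i (x ord0 i)].
  move=> mB; rewrite (_ : [set _ | _] =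
      \bigcap_(i in [set: 'I_m]) (coord_rV i @^-1` B i)).
    apply: fin_bigcap_measurable => // i _.
    by rewrite -[X in measurable X]setTI; exact: measurable_coord_rV.
  by apply/seteqP; split => x /= Bx i; [move=> _|]; exact: Bx.
elim: n A => [|n ih] A mA.
  by rewrite big_ord0 /= diracE mem_set// => -[].
rewrite big_ord_recl -(ih (fun i => A (lift ord0 i))); last first.
  by move=> i; exact: mA.
rewrite /= /lebesgue_rV_step.
have mA' := mbox n (fun i => A (lift ord0 i)) (fun i => mA (lift ord0 i)).
apply: etrans
  (product_measure1E lebesgue_measure (lebesgue_rV n) (mA ord0) mA').
congr (product_measure1 _ _ _).
apply/seteqP; split => -[a x] /=.
- move=> Aax; split => [|i].
    by have := Aax ord0; rewrite mxE unlift_none.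
  by have := Aax (lift ord0 i); rewrite mxE liftK.
- move=> [Aa Ax] i; rewrite mxE.
  by case: (unliftP ord0 i) => [j ->|->]; [exact: Ax|].
Qed.

End lebesgue_rV.

Section sphere_measure.
Context (R : realType) (d : nat).

Lemma measurable_dotmul :
  measurable_fun [set: 'rV[R]_d] (fun x : 'rV[R]_d => dotmul x x).
Proof.
by apply: measurable_sum => i; apply: measurable_funM;
  exact: measurable_coord_rV.
Qed.

Lemma dotmul_ge0 (x : 'rV[R]_d) : 0 <= dotmul x x.
Proof. by apply: sumr_ge0 => i _; rewrite -expr2 sqr_ge0. Qed.

Lemma measurable_enorm :
  measurable_fun [set: 'rV[R]_d] (@enorm R d).
Proof.
rewrite (_ : @enorm R d = (@powR R ^~ 2^-1) \o (fun x => dotmul x x)).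
  by apply: measurableT_comp; [exact: measurable_powR|exact: measurable_dotmul].
by apply/funext => x /=; rewrite powR12_sqrt ?dotmul_ge0.
Qed.

Lemma measurable_unit_ball : measurable (unit_ball R d).
Proof.
rewrite (_ : unit_ball R d = @enorm R d @^-1` `]-oo, 1]).
  by rewrite -[X in measurable X]setTI; exact: measurable_enorm.
by apply/seteqP; split => x /=; rewrite in_itv.
Qed.

(* Radial projection onto the sphere; [direction 0 = 0] is not on the sphere. *)
Definition direction (x : 'rV[R]_d) : 'rV[R]_d := (enorm x)^-1 *: x.

Lemma measurable_direction : measurable_fun [set: 'rV[R]_d] direction.
Proof.
apply/measurable_fun_rVP => i.
rewrite (_ : _ \o _ = (fun x => (enorm x `^ (- 1)) * coord_rV i x)).
  apply: measurable_funM; last exact: measurable_coord_rV.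
  apply: (@measurableT_comp _ _ _ _ _ _ (@powR R ^~ (- 1))).
    exact: measurable_powR.
  exact: measurable_enorm.
apply/funext => x; rewrite /= /coord_rV mxE -powR_inv1//.
exact: sqrtr_ge0.
Qed.

Definition kappa : R := fine (lebesgue_rV d (unit_ball R d)).

(* For [A] in the sphere, its normalized surface area, i.e. the proportion
   of the unit ball covered by the cone { t u | u \in A, 0 < t <= 1 }. *)
Definition sphere_measure (A : set 'rV[R]_d) : \bar R :=
  (kappa^-1%:E * lebesgue_rV d (unit_ball R d `&` direction @^-1` A))%E.

Lemma kappa_ge0 : 0 <= kappa.
Proof. by apply: fine_ge0; exact: measure_ge0. Qed.

Let sphere_measure0 : sphere_measure set0 = 0%E.
Proof. by rewrite /sphere_measure preimage_set0 setI0 measure0 mule0. Qed.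

Let sphere_measure_ge0 A : (0 <= sphere_measure A)%E.
Proof.
by apply: mule_ge0; [rewrite lee_fin invr_ge0 kappa_ge0|exact: measure_ge0].
Qed.

Let sphere_measure_sigma_additive : semi_sigma_additive sphere_measure.
Proof.
pose r : {nonneg R} := NngNum (etrans (invr_ge0 kappa) kappa_ge0).
pose mu := mscale r (mrestr (lebesgue_rV d) measurable_unit_ball).
have -> : sphere_measure = fun A => mu (direction @^-1` A).
  by apply/funext => A; rewrite /sphere_measure setIC.
move=> F mF tF mUF; rewrite preimage_bigcup.
apply: measure_semi_sigma_additive.
- by move=> n; rewrite -[X in measurable X]setTI; exact: measurable_direction.
- apply/trivIsetP => /= i j _ _ ij; rewrite -preimage_setI.
  by move/trivIsetP : tF => /(_ _ _ _ _ ij) ->//; rewrite preimage_set0.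
- rewrite -preimage_bigcup -[X in measurable X]setTI.
  exact: measurable_direction.
Qed.

HB.instance Definition _ := isMeasure.Build _ _ _ sphere_measure
  sphere_measure0 sphere_measure_ge0 sphere_measure_sigma_additive.

End sphere_measure.
Arguments kappa R d : clear implicits.
Arguments sphere_measure R d : clear implicits.

(* The surface area of the unit sphere, expressed through the volume of the
   ball. *)
Definition omega (R : realType) (d : nat) : R := d%:R * kappa R d.

Definition convex_hull {R : realType} {d : nat} (A : set 'rV[R]_d) :
    set 'rV[R]_d :=
  smallest (@convex_set R 'rV[R]_d) A.

Definition polytope {R : realType} {d : nat} (P : set 'rV[R]_d) : Prop :=
  exists2 A : set 'rV[R]_d, finite_set A & P = convex_hull A.

Definition affine_set {R : realType} {d : nat} (A : set 'rV[R]_d) : Prop :=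
  forall (x y : 'rV[R]_d) (t : R), A x -> A y -> A (t *: x + (1 - t) *: y).

Definition affine_hull {R : realType} {d : nat} (A : set 'rV[R]_d) :
    set 'rV[R]_d :=
  smallest affine_set A.

(* False for the empty set, whose dimension is usually taken to be -1. *)
Definition has_dim {R : realType} {d : nat} (A : set 'rV[R]_d) (k : nat) :
    Prop :=
  exists (x : 'rV[R]_d) (V : {vspace 'rV[R]_d}),
    \dim V = k /\ affine_hull A = [set y | y - x \in V].

(* Intersection of [P] with a supporting hyperplane. A full-dimensional [P] is
   not itself a face in this sense, while the empty set may be one. *)
Definition face {R : realType} {d : nat} (P F : set 'rV[R]_d) : Prop :=
  exists (u : 'rV[R]_d) (b : R),
    [/\ u != 0, (forall x, P x -> dotmul u x <= b)
      & F = P `&` [set x | dotmul u x = b]].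

Definition k_faces {R : realType} {d : nat} (k : nat) (P : set 'rV[R]_d) :
    set (set 'rV[R]_d) :=
  [set F | face P F /\ has_dim F k].

Definition Gamma {R : realType} (x : R) : R :=
  \int[@lebesgue_measure R]_(t in `]0, +oo[) (t `^ (x - 1) * expR (- t)).

(* The dual volume of the unit ball, for 0 <= q <= d. *)
Definition dual_volume_ball {R : realType} (d : nat) (q : R) : R :=
  pi `^ (q / 2)
  * (Gamma (d%:R + 1) / (Gamma (q + 1) * Gamma (d%:R - q + 1)))
  * (Gamma ((d%:R - q) / 2 + 1) / Gamma (d%:R / 2 + 1)).

Definition c1 {R : realType} (d : nat) (q : R) : R :=
  if `|q| <= d%:R then dual_volume_ball d `|q| else kappa R d.

Definition radial {R : realType} {d : nat} (K : set 'rV[R]_d) (u : 'rV[R]_d) :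
    R :=
  sup [set l : R | 0 <= l /\ K (l *: u)].

(* Used for q != 0 only. *)
Definition dual_deviation {R : realType} {d : nat} (q : R)
    (K L : set 'rV[R]_d) : R :=
  c1 d q * \int[sphere_measure R d]_(u in unit_sphere R d)
             `|radial K u `^ q - radial L u `^ q|.

Definition log_volume {R : realType} {d : nat} (K : set 'rV[R]_d) : R :=
  \int[sphere_measure R d]_(u in unit_sphere R d) ln (radial K u).

Definition log_deviation {R : realType} {d : nat} (K L : set 'rV[R]_d) : R :=
  log_volume K + log_volume L - 2 * log_volume (K `&` L).

(* Main.v *)
(* Let [P] be the polar of [Q]; since [Q] contains the unit ball, [P] lies in
   it, and [radial Q u] is the inverse of the maximum of [<v, u>] over the
   vertices [v] of [P]. If [radial Q u < sqrt (1 + delta)], then [u] lies in one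
   of the caps of angular radius [arctan (sqrt delta)] around the directions of
   these vertices, and comparing a cap with the disc above it in the tangent
   hyperplane shows that, when there are at most [M] vertices, these caps cover
   at most 1/4 of the sphere. So [radial Q >= sqrt (1 + delta)] on 3/4 of the
   sphere, and the rest is calculus.

   It remains to see that [P] has at most as many vertices as [Q] has k-faces,
   i.e. as [P] has j-faces, where [j = d - 1 - k <= d / 2]. Fix a linear form [l]
   injective on the vertices. A vertex [v] is determined by a face of [P] on
   which it maximizes (or minimizes) [l]. Conversely, in the tangent cone of [P]
   at [v] there are two faces, one on which [l] is nonnegative and one on which
   it is nonpositive, whose dimensions add up to at least [d]; hence [v] is
   extremal for [l] on at least two j-faces (counted with the sign of [l]), and
   double counting gives the inequality. *)

Require Import Defs.
From HB Require Import structures.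
From mathcomp Require Import all_boot all_order all_algebra.
From mathcomp Require Import all_classical all_reals all_analysis.
From mathcomp Require Import measurable_realfun ring lra zify.

Set Implicit Arguments.
Unset Strict Implicit.
Unset Printing Implicit Defensive.

Import Order.TTheory GRing.Theory Num.Theory.
Import numFieldNormedType.Exports.

Local Open Scope classical_set_scope.
Local Open Scope ring_scope.

(** * Inner product and generic vectors *)

Section dotmul_theory.
Context {R : realType} {d : nat}.
Implicit Types (x y z : 'rV[R]_d) (t : R).

Lemma dotmulE x y : dotmul x y = (x *m y^T) ord0 ord0.
Proof. by rewrite mxE; apply: eq_bigr => i _; rewrite mxE. Qed.

Lemma dotmulC x y : dotmul x y = dotmul y x.
Proof. by apply: eq_bigr => i _; rewrite mulrC. Qed.

Lemma dotmulDl x y z : dotmul (x + y) z = dotmul x z + dotmul y z.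
Proof. by rewrite !dotmulE mulmxDl mxE. Qed.

Lemma dotmulZl t x y : dotmul (t *: x) y = t * dotmul x y.
Proof. by rewrite !dotmulE -scalemxAl mxE. Qed.

Lemma dotmulNl x y : dotmul (- x) y = - dotmul x y.
Proof. by rewrite -scaleN1r dotmulZl mulN1r. Qed.

Lemma dotmulBl x y z : dotmul (x - y) z = dotmul x z - dotmul y z.
Proof. by rewrite dotmulDl dotmulNl. Qed.

Lemma dot0mul x : dotmul 0 x = 0.
Proof. by rewrite dotmulE mul0mx mxE. Qed.

Lemma dotmulDr x y z : dotmul z (x + y) = dotmul z x + dotmul z y.
Proof. by rewrite !(dotmulC z) dotmulDl. Qed.

Lemma dotmulZr t x y : dotmul y (t *: x) = t * dotmul y x.
Proof. by rewrite !(dotmulC y) dotmulZl. Qed.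

Lemma dotmulNr x y : dotmul y (- x) = - dotmul y x.
Proof. by rewrite !(dotmulC y) dotmulNl. Qed.

Lemma dotmulBr x y z : dotmul z (x - y) = dotmul z x - dotmul z y.
Proof. by rewrite dotmulDr dotmulNr. Qed.

Lemma dotmul0 x : dotmul x 0 = 0.
Proof. by rewrite dotmulC dot0mul. Qed.

Lemma dotmul_sumr (I : finType) (P : pred I) (f : I -> 'rV[R]_d) x :
  dotmul x (\sum_(i | P i) f i) = \sum_(i | P i) dotmul x (f i).
Proof. by apply: (big_morph _ (fun u v => dotmulDr u v x) (dotmul0 x)). Qed.

Lemma dotmul_eq0 x : (dotmul x x == 0) = (x == 0).
Proof.
apply/eqP/eqP => [|->]; last exact: dot0mul.
move=> /eqP; rewrite psumr_eq0 => [/allP h|i _]; last by rewrite -expr2 sqr_ge0.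
apply/rowP => i; rewrite mxE; apply/eqP.
by have := h i (mem_index_enum i); rewrite /= mulf_eq0 orbb.
Qed.

Lemma sub_kermx_dotmul x y : (x <= kermx y^T)%MS = (dotmul x y == 0).
Proof.
apply/sub_kermxP/eqP => [h|h]; first by rewrite dotmulE h mxE.
by apply/rowP => i; rewrite ord1 -dotmulE h mxE.
Qed.

Lemma sub_cap_kermx m (A : 'M[R]_(m, d)) x y :
  (x <= A :&: kermx y^T)%MS = (x <= A)%MS && (dotmul x y == 0).
Proof. by rewrite sub_capmx sub_kermx_dotmul. Qed.

End dotmul_theory.

Section avoid.
Context {R : realType} {d : nat}.
Implicit Types (w v : 'rV[R]_d) (U W : 'M[R]_d).

(** A subspace containing two points of the line through [w] in direction [v] contains both [w] and
    [v]. So each [U] meets the line in at most one parameter, and [e] is taken below the positive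
    ones. *)
Lemma line_avoid (Us : seq 'M[R]_d) w v :
    {in Us, forall U, ~~ (w <= U)%MS || ~~ (v <= U)%MS} ->
  exists2 e : R, 0 < e &
    forall t : R, 0 < t < e -> {in Us, forall U, ~~ ((w + t *: v)%R <= U)%MS}.
Proof.
elim: Us => [|U Us ih] h; first by exists 1.
have [|e e0 he] := ih; first by move=> V VUs; apply: h; rewrite in_cons VUs orbT.
have [[t0 t00 ht0]|no] := pselect (exists2 t0 : R, 0 < t0 & ((w + t0 *: v)%R <= U)%MS).
  exists (Num.min e t0); first by rewrite lt_min e0.
  move=> t /andP[t1]; rewrite lt_min => /andP[te tt0] V.
  rewrite in_cons => /orP[/eqP ->|]; last by apply: he; rewrite t1.
  apply/negP => ht.
  have vU : (v <= U)%MS.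
    have : ((w + t0 *: v - (w + t *: v))%R <= U)%MS.
      by rewrite addmx_sub// eqmx_opp.
    rewrite opprD addrACA subrr add0r -scalerBl => /(scalemx_sub (t0 - t)^-1).
    by rewrite scalerA mulVf ?scale1r// subr_eq0 gt_eqF.
  have wU : (w <= U)%MS.
    by rewrite -(addrK (t *: v) w) addmx_sub// eqmx_opp scalemx_sub.
  by have := h U (mem_head _ _); rewrite wU vU.
exists e => // t te V; rewrite in_cons => /orP[/eqP ->|]; last exact: he.
by apply/negP => ht; apply: no; exists t => //; case/andP: te.
Qed.

(** A real vector space is not a finite union of proper subspaces: a vector avoiding the earlier
    ones is moved slightly towards a row of [W] outside the new one. *)
Lemma subspace_avoid (Us : seq 'M[R]_d) W :
    {in Us, forall U, ~~ (W <= U)%MS} ->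
  exists2 w : 'rV[R]_d, (w <= W)%MS & {in Us, forall U, ~~ (w <= U)%MS}.
Proof.
elim: Us => [|U Us ih] h; first by exists 0; rewrite ?sub0mx.
have [|w wW hw] := ih; first by move=> V VUs; apply: h; rewrite in_cons VUs orbT.
have /row_subPn[i hi] := h U (mem_head _ _).
have [|e e0 he] := @line_avoid (U :: Us) w (row i W).
  move=> V; rewrite in_cons => /orP[/eqP ->|VUs]; first by rewrite hi orbT.
  by rewrite hw.
exists (w + (e / 2) *: row i W).
  by rewrite addmx_sub// scalemx_sub// row_sub.
by apply: he; lra.
Qed.

Lemma small_scale (I : finType) (P : pred I) (f g : I -> R) :
    (forall i, P i -> 0 < f i) ->
  exists2 e : R, 0 < e & forall t : R, 0 < t < e -> forall i, P i -> t * g i < f i.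
Proof.
move=> f0; pose e := \big[Num.min/1]_(i | P i) (f i / (`|g i| + 1)).
exists e.
  rewrite /e; elim/big_ind: _ => //; first by move=> x y x0 y0; rewrite lt_min x0.
  by move=> i Pi; rewrite divr_gt0 ?f0// ltr_wpDl.
move=> t /andP[t0 te] i Pi.
have : t < f i / (`|g i| + 1) by apply: (lt_le_trans te); apply: bigmin_le_cond.
rewrite ltr_pdivlMr ?ltr_wpDl// => h; apply: le_lt_trans h.
by rewrite ler_pM2l// (le_trans (ler_norm _))// lerDl.
Qed.

End avoid.

(** * Vertices of polyhedra *)

Section polyhedron.
Context {R : realType} {d : nat} {I : finType}.
Variable a : I -> 'rV[R]_d.
Implicit Types (S T : {set I}) (b : I -> R) (y z w l : 'rV[R]_d).

(** Rows outside [S] are zero, so that all index sets share one matrix type; the row space is the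
    span of the [a i] with [i] in [S]. *)
Definition gens S : 'M[R]_(#|I|, d) :=
  \matrix_(j < #|I|) (if enum_val j \in S then a (enum_val j) else 0).

Definition rk S := \rank (gens S).

Definition perp S : 'M[R]_d := kermx (gens S)^T.

Definition poly T b y := forall i, i \in T -> dotmul y (a i) <= b i.

Definition tight T b y : {set I} := [set i in T | dotmul y (a i) == b i].

Lemma perpP S y :
  reflect (forall i, i \in S -> dotmul y (a i) = 0) (y <= perp S)%MS.
Proof.
apply: (iffP sub_kermxP) => [h i iS|h].
  have /rowP/(_ (enum_rank i)) := h; rewrite !mxE => <-.
  by apply: eq_bigr => j _; rewrite !mxE enum_rankK iS.
apply/rowP => j; rewrite !mxE.
under eq_bigr do rewrite !mxE; case: ifP => jS; last first.
  by rewrite big1// => i _; rewrite mxE mulr0.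
exact: h.
Qed.

Lemma gens_row S i : i \in S -> (a i <= gens S)%MS.
Proof.
move=> iS; have <- : row (enum_rank i) (gens S) = a i; last exact: row_sub.
by apply/rowP => j; rewrite !mxE enum_rankK iS.
Qed.

Lemma rk_le S : (rk S <= d)%N.
Proof. exact: rank_leq_col. Qed.

Lemma rank_perp S : \rank (perp S) = (d - rk S)%N.
Proof. by rewrite mxrank_ker mxrank_tr. Qed.

Lemma perpS S T : S \subset T -> (perp T <= perp S)%MS.
Proof.
move=> /fintype.subsetP ST; apply/row_subP => i.
have /perpP h : (row i (perp T) <= perp T)%MS by exact: row_sub.
by apply/perpP => j jS; apply/h/ST.
Qed.

Lemma rkS S T : S \subset T -> (rk S <= rk T)%N.
Proof.
move=> /perpS/mxrankS; rewrite !rank_perp.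
by have := rk_le S; have := rk_le T; lia.
Qed.

Lemma ltn_rk S T y : S \subset T -> (y <= perp S)%MS -> ~~ (y <= perp T)%MS ->
  (rk S < rk T)%N.
Proof.
move=> ST yS yT; have : (perp T < perp S)%MS.
  by rewrite /ltmx perpS//=; apply/negP => /(submx_trans yS); exact/negP.
rewrite ltmxErank => /andP[_]; rewrite !rank_perp.
by have := rk_le S; have := rk_le T; lia.
Qed.

Lemma perp_full S y : rk S = d -> (y <= perp S)%MS = (y == 0).
Proof.
move=> rS; have : \rank (perp S) = 0%N by rewrite rank_perp rS subnn.
by move=> /eqP; rewrite mxrank_eq0 => /eqP ->; rewrite submx0.
Qed.

Lemma perp_proper S : (rk S < d)%N -> exists2 w : 'rV[R]_d, w != 0 & (w <= perp S)%MS.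
Proof.
move=> rS; have : perp S != 0 by rewrite -mxrank_eq0 rank_perp; lia.
by move=> /rowV0Pn[w ? ?]; exists w.
Qed.

Lemma tight_sub T b y : tight T b y \subset T.
Proof. by apply/fintype.subsetP => i; rewrite inE => /andP[]. Qed.

Lemma tightP T b y i : i \in tight T b y -> dotmul y (a i) = b i.
Proof. by rewrite inE => /andP[_ /eqP]. Qed.

Lemma vertex_inj T b y z : rk (tight T b y) = d ->
  tight T b y \subset tight T b z -> y = z.
Proof.
move=> ry /fintype.subsetP yz; apply/eqP; rewrite -subr_eq0 -(perp_full _ ry).
apply/perpP => i iy; rewrite dotmulBl (tightP iy) (tightP (yz i iy)).
exact: subrr.
Qed.

(** The ratio test of the simplex method: [w] keeps the tight constraints tight, and the first
    constraint hit on the way is not orthogonal to [w], so the rank goes up. *)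
Lemma poly_exit T b y w : poly T b y -> (w <= perp (tight T b y))%MS ->
    (exists2 i, i \in T & 0 < dotmul w (a i)) ->
  exists t : R, [/\ 0 <= t, poly T b (y + t *: w),
    tight T b y \subset tight T b (y + t *: w) &
    (rk (tight T b y) < rk (tight T b (y + t *: w)%R))%N].
Proof.
move=> Py /perpP wy [i0 i0T wi0].
pose q i := (b i - dotmul y (a i)) / dotmul w (a i).
pose Pi i := (i \in T) && (0 < dotmul w (a i)).
have Pi0 : Pi i0 by rewrite /Pi i0T.
have [m /andP[mT wm] hm] := arg_minP q Pi0.
have q0 : 0 <= q m by rewrite /q divr_ge0 ?(ltW wm)// subr_ge0 Py.
have P' : poly T b (y + q m *: w).
  move=> i iT; rewrite dotmulDl dotmulZl; have [wi|wi] := ltP 0 (dotmul w (a i)).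
    rewrite -lerBrDl -ler_pdivlMr//; apply: hm; exact/andP.
  by apply: le_trans (Py i iT); rewrite gerDl mulr_ge0_le0.
have st : tight T b y \subset tight T b (y + q m *: w).
  apply/fintype.subsetP => i iy; rewrite inE (fintype.subsetP (tight_sub T b y))//=.
  by rewrite dotmulDl dotmulZl wy// mulr0 addr0 (tightP iy).
exists (q m); split => //; apply: (@ltn_rk _ _ w) => //; first exact/perpP.
apply/negP => /perpP h; have := h m.
suff mt : m \in tight T b (y + q m *: w).
  by move=> /(_ mt) w0; rewrite w0 ltxx in wm.
rewrite inE mT/= dotmulDl dotmulZl /q divfK ?(gt_eqF wm)//.
by rewrite addrC subrK.
Qed.

(** The recession cone is trivial, so [poly T b] is bounded whatever [b] is. *)
Definition bounded_dir T :=
  forall w, w != 0 -> exists2 i, i \in T & 0 < dotmul w (a i).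

(** As long as the rank is below [d], some line keeps the tight constraints; follow it in the sense
    in which [l] does not decrease, up to the next constraint. *)
Lemma poly_vertex T b y l : bounded_dir T -> poly T b y ->
  exists v, [/\ poly T b v, rk (tight T b v) = d & dotmul l y <= dotmul l v].
Proof.
move=> bd; have [n] := ubnP (d - rk (tight T b y)).
elim: n y => // n ih y hn Py.
have := rk_le (tight T b y); rewrite leq_eqVlt => /orP[/eqP yd|yd].
  by exists y; rewrite lexx.
have [w w0 wy] := perp_proper yd.
wlog lw : w w0 wy / 0 <= dotmul l w.
  move=> h; have [|lw] := leP 0 (dotmul l w); first exact: h.
  apply: (h (- w)); first by rewrite oppr_eq0.
    by rewrite eqmx_opp.
  by rewrite dotmulNr oppr_ge0 ltW.
have [t [t0 Pt _ rt]] := poly_exit Py wy (bd w w0).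
have [|//|v [Pv vd lv]] := ih (y + t *: w); first by lia.
exists v; split => //; apply: le_trans lv.
by rewrite dotmulDr dotmulZr lerDl mulr_ge0.
Qed.

(** A vertex is determined by its tight set, so there are finitely many, and by [poly_vertex] the
    best of them is optimal. This replaces compactness. *)
Lemma poly_max T b y l : bounded_dir T -> poly T b y ->
  exists2 v, poly T b v & forall z, poly T b z -> dotmul l z <= dotmul l v.
Proof.
move=> bd Py.
pose V S := `[< exists v, [/\ poly T b v, rk S = d & tight T b v = S] >].
have [v0 [Pv0 v0d _]] := poly_vertex l bd Py.
have V0 : V (tight T b v0) by apply/asboolP; exists v0.
pose vert S := xget 0 [set v | [/\ poly T b v, rk S = d & tight T b v = S]].
have vertP S : V S -> [/\ poly T b (vert S), rk S = d & tight T b (vert S) = S].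
  move=> /asboolP[v hv]; rewrite /vert; case: xgetP => [u _//|/(_ v)] //.
have [S VS hS] := arg_maxP (fun S => dotmul l (vert S)) V0.
have [PvS _ _] := vertP _ VS.
exists (vert S) => // z Pz.
have [v [Pv vd lv]] := poly_vertex l bd Pz.
have Vv : V (tight T b v) by apply/asboolP; exists v.
have [Pv' vd' v'v] := vertP _ Vv.
apply: (le_trans lv); have <- : vert (tight T b v) = v; last exact: hS.
by apply/esym/(vertex_inj (b := b) vd); rewrite v'v.
Qed.

End polyhedron.

(** * Faces of polyhedral cones *)

Section cone.
Context {R : realType} {d : nat} {I : finType}.
Variable a : I -> 'rV[R]_d.
Implicit Types (S T : {set I}) (y z w l c : 'rV[R]_d).

Notation rk := (rk a).
Notation perp := (perp a).
Notation cone T := (poly a T (fun=> 0)).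
Notation ctight T := (tight a T (fun=> 0)).

Lemma ctight_perp T z : (z <= perp (ctight T z))%MS.
Proof. by apply/perpP => i /tightP. Qed.

Lemma ctight0 T : ctight T 0 = T.
Proof. by apply/setP => i; rewrite inE dot0mul eqxx andbT. Qed.

(** All terms are nonpositive, and they cannot all vanish on a family of full rank. The sum of the
    generators is thus a linear form whose negative level sets cut the cone in bounded sections. *)
Lemma cone_sum_lt0 T z : rk T = d -> cone T z -> z != 0 ->
  dotmul z (\sum_(i in T) a i) < 0.
Proof.
move=> rT Cz z0; rewrite dotmul_sumr lt_neqAle sumr_le0// andbT.
rewrite -oppr_eq0 -sumrN; apply: contra z0 => /eqP h.
rewrite -(perp_full (a := a) z rT); apply/perpP => i iT; apply/eqP; rewrite -oppr_eq0.
move: h => /eqP; rewrite psumr_eq0 => [/allP/(_ i (mem_index_enum i))|j jT].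
  by rewrite iT.
by rewrite oppr_ge0; exact: Cz.
Qed.

Lemma cone_facet_line T z w : cone T z ->
    (w <= perp (ctight T z))%MS ->
    (exists2 i, i \in T & 0 < dotmul w (a i)) ->
    (forall S, S \subset T -> (rk (ctight T z)).+2 <= rk S ->
      ~~ (w <= perp S + z)%MS)%N ->
  exists t : R, [/\ 0 < t, cone T (z + t *: w),
    ctight T z \subset ctight T (z + t *: w) &
    rk (ctight T (z + t *: w)) = (rk (ctight T z)).+1].
Proof.
move=> Cz wz iw avoid; have [t [t0 Ct st rt]] := poly_exit Cz wz iw.
have t0' : 0 < t.
  rewrite lt_neqAle t0 andbT; apply/eqP => t00.
  by move: rt; rewrite -t00 scale0r addr0 ltnn.
exists t; split => //; apply/eqP; rewrite eqn_leq rt andbT leqNgt.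
apply/negP => /(avoid (ctight T (z + t *: w)) (tight_sub _ _ _ _)) /negP; apply.
(* If the rank jumped by two or more, this identity would put [w] in one of the subspaces excluded
   by [avoid]. *)
have wE : w = t^-1 *: (z + t *: w) - t^-1 *: z.
  by rewrite scalerDr addrAC subrr add0r scalerA mulVf ?scale1r// gt_eqF.
rewrite [X in (X <= _)%MS]wE.
apply: addmx_sub; last by rewrite eqmx_opp scalemx_sub// addsmxSr.
by apply: scalemx_sub; apply: submx_trans (ctight_perp T _) (addsmxSl _ _).
Qed.

(* Cut the face of [z] by a generic line through [z] in a hyperplane where the
   cone has a bounded section; it leaves the face at two relative facets. *)
Lemma cone_facets T z : rk T = d -> cone T z -> ((rk (ctight T z)).+2 <= d)%N ->
  exists z1 z2, [/\ cone T z1 /\ cone T z2,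
    ctight T z \subset ctight T z1 /\ ctight T z \subset ctight T z2,
    rk (ctight T z1) = (rk (ctight T z)).+1,
    rk (ctight T z2) = (rk (ctight T z)).+1 &
    ctight T z1 != ctight T z2].
Proof.
move=> rT Cz rz; pose r : nat := rk (ctight T z); rewrite -/r in rz *.
have z0 : z != 0.
  by apply/eqP => z0; move: rz; rewrite /r z0 ctight0 rT; lia.
pose e := \sum_(i in T) a i.
have ez := cone_sum_lt0 rT Cz z0.
(* Directions in the span of the face of [z] along which the form [e] is constant. *)
pose W := (perp (ctight T z) :&: kermx e^T)%MS.
have rW : (d - r <= (\rank W).+1)%N.
  have := mxrank_sum_cap (perp (ctight T z)) (kermx e^T).
  rewrite rank_perp mxrank_ker -/W -/r.
  have := rank_leq_col (perp (ctight T z) + kermx e^T)%MS.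
  by have := rank_leq_col e^T; lia.
have [|w wW hw] := @subspace_avoid R d
    [seq (perp X + z)%MS | X : {set I} <- enum {: {set I}}
      & (X \subset T) && (r.+2 <= rk X)%N] W.
  move=> U /mapP[S]; rewrite mem_filter => /andP[/andP[ST rS] _] ->.
  apply/negP => WU.
  (* Dimension count: [W + z] has dimension at least [d - r], since [z] is not in [W], while
     [perp S + z] has dimension at most [d - r - 1]. *)
  have zW : ~~ (z <= W)%MS.
    by rewrite sub_cap_kermx (lt_eqF ez) andbF.
  have : (W < W + z)%MS.
    rewrite /ltmx addsmxSl/=; apply: contra zW; apply: submx_trans.
    exact: addsmxSr.
  rewrite ltmxErank => /andP[_].
  have : (W + z <= perp S + z)%MS by rewrite addsmx_sub WU addsmxSr.
  move=> /mxrankS; have [+ _] := mxrank_adds_leqif (perp S) z.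
  rewrite rank_perp; have := rank_leq_row z.
  lia.
have avoid w' : (w' == w) || (w' == - w) -> forall S, S \subset T -> (r.+2 <= rk S)%N ->
    ~~ (w' <= perp S + z)%MS.
  move=> ww S ST rS; have : ~~ (w <= perp S + z)%MS.
    apply: hw; apply/mapP; exists S => //.
    by rewrite mem_filter ST rS mem_enum.
  by case/orP : ww => /eqP -> //; rewrite eqmx_opp.
have [wz] : (w <= perp (ctight T z))%MS /\ dotmul w e = 0.
  by move: wW; rewrite sub_cap_kermx => /andP[-> /eqP].
rewrite /e dotmul_sumr => we.
have w0 : w != 0.
  apply/eqP => w0; have := avoid w; rewrite eqxx => /(_ isT T (subxx _)).
  by rewrite w0 sub0mx rT => /(_ rz).
have posdir v : v != 0 -> \sum_(i in T) dotmul v (a i) = 0 ->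
    exists2 i, i \in T & 0 < dotmul v (a i).
  move=> v0 ve; apply/exists2P; apply: contrapT => /forallNP no.
  suff Cv : cone T v by have := cone_sum_lt0 rT Cv v0; rewrite dotmul_sumr ve ltxx.
  by move=> i iT; rewrite leNgt; apply/negP => ?; apply: (no i).
have [|t1 [t10 C1 s1 r1]] := @cone_facet_line T z w Cz wz (posdir w w0 we).
- by apply: avoid; rewrite eqxx.
have wz' : ((- w)%R <= perp (ctight T z))%MS by rewrite eqmx_opp.
have [||t2 [t20 C2 s2 r2]] := @cone_facet_line T z (- w) Cz wz'.
- apply: posdir; first by rewrite oppr_eq0.
  by under eq_bigr do rewrite dotmulNl; rewrite sumrN we oppr0.
- by apply: avoid; rewrite eqxx orbT.
exists (z + t1 *: w), (z + t2 *: - w); split => //.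
(* The two exit points lie on opposite sides of [z]. A constraint tight at both is tight at [z], so
   equal tight sets would contradict the increase of the rank. *)
apply/eqP => e12; have : ctight T (z + t1 *: w) \subset ctight T z.
  apply/fintype.subsetP => i i1; have i2 := i1; rewrite e12 in i2.
  have iT := fintype.subsetP (tight_sub _ _ _ _) i i1.
  have := tightP i1; have := tightP i2.
  rewrite !dotmulDl !dotmulZl dotmulNl => h2 h1.
  have : (t1 + t2) * dotmul w (a i) = 0 by lra.
  move=> /eqP; rewrite mulf_eq0 gt_eqF ?addr_gt0//= => /eqP wi.
  by move: h1; rewrite wi mulr0 addr0 => h1; rewrite inE iT h1 eqxx.
by move=> /(rkS a); rewrite r1; lia.
Qed.

Lemma cone_chain T z r : rk T = d -> cone T z -> (rk (ctight T z) <= r < d)%N ->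
  exists z', [/\ cone T z', ctight T z \subset ctight T z' & rk (ctight T z') = r].
Proof.
move=> rT; have [n] := ubnP (r - rk (ctight T z)); elim: n z => // n ih z hn Cz.
move=> /andP[]; rewrite leq_eqVlt => /orP[/eqP <- _|rz rd]; first by exists z.
have [|z1 [_ [[C1 _] [s1 _] r1 _ _]]] := cone_facets rT Cz; first by lia.
have [|//||z' [C' s' r']] := ih z1; rewrite ?r1 ?rz//; first by lia.
by exists z'; split => //; exact: fintype.subset_trans s1 s'.
Qed.

Lemma cone_chain2 T z r : rk T = d -> cone T z -> (rk (ctight T z) < r < d)%N ->
  exists z1 z2, [/\ cone T z1 /\ cone T z2,
    ctight T z \subset ctight T z1 /\ ctight T z \subset ctight T z2,
    rk (ctight T z1) = r, rk (ctight T z2) = r & ctight T z1 != ctight T z2].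
Proof.
move=> rT Cz /andP[rz rd].
have [|z' [C' s' r']] := @cone_chain T z r.-1 rT Cz; first by lia.
have [|z1 [z2 [[C1 C2] [s1 s2] r1 r2 n12]]] := cone_facets rT C'; first by lia.
exists z1, z2; rewrite r1 r2 r' prednK; last by lia.
by split => //; split; apply: fintype.subset_trans s' _.
Qed.

End cone.

Section cone_split.
Context {R : realType} {d : nat} {I : finType}.
Variable a : I -> 'rV[R]_d.
Implicit Types (S T : {set I}) (y z w l c : 'rV[R]_d).

Notation rk := (rk a).
Notation perp := (perp a).
Notation cone T := (poly a T (fun=> 0)).
Notation ctight T := (tight a T (fun=> 0)).

(** [w] lies in the minimal face of [z]: constraints tight at [z] are unaffected by it, and the
    others have slack. *)
Lemma cone_sub_small T z w : cone T z -> ctight T z \subset ctight T w ->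
  exists2 e : R, 0 < e & cone T (z - e *: w).
Proof.
move=> Cz /fintype.subsetP zw.
have [|e e0 he] := @small_scale R I (fun i => (i \in T) && (i \notin ctight T z))
    (fun i => - dotmul z (a i)) (fun i => - dotmul w (a i)).
  move=> i /andP[iT]; rewrite inE iT/= => iz.
  by rewrite oppr_gt0 lt_neqAle iz Cz.
exists (e / 2); first by rewrite divr_gt0.
move=> i iT; rewrite dotmulBl dotmulZl.
have [iz|iz] := boolP (i \in ctight T z).
  by rewrite (tightP iz) (tightP (zw i iz)) mulr0 subrr.
have := he (e / 2) _ i; rewrite iT iz => /(_ _ isT); lra.
Qed.

(** Perturb the interior point [c0] so that it avoids every proper subspace of the form
    [perp S1 + perp S2]. A sum containing [c] is then the whole space, and counting dimensions
    bounds the ranks. *)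
Lemma cone_generic T c0 : (forall i, i \in T -> dotmul c0 (a i) < 0) ->
  exists2 c, cone T c & forall S1 S2,
    (c <= perp S1 + perp S2)%MS -> (rk S1 + rk S2 <= d)%N.
Proof.
move=> Cc0.
pose Us := [seq (perp X.1 + perp X.2)%MS | X : {set I} * {set I}
  <- enum {: {set I} * {set I}} & (\rank (perp X.1 + perp X.2)%MS < d)%N].
have [|u _ hu] := @subspace_avoid R d Us 1%:M.
  move=> U /mapP[X]; rewrite mem_filter => /andP[rX _] ->.
  by apply/negP => /mxrankS; rewrite mxrank1 leqNgt rX.
have [|e1 e10 he1] := @line_avoid R d Us c0 u.
  by move=> U UUs; rewrite (hu U UUs) orbT.
have [|e2 e20 he2] := @small_scale R I (mem T)
    (fun i => - dotmul c0 (a i)) (fun i => dotmul u (a i)).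
  by move=> i iT; rewrite oppr_gt0; exact: Cc0.
pose t := Num.min e1 e2 / 2.
have m0 : 0 < Num.min e1 e2 by rewrite lt_min e10.
have /andP[t1 t2] : (t < e1) && (t < e2).
  by rewrite -lt_min /t; lra.
have t0 : 0 < t by rewrite divr_gt0.
exists (c0 + t *: u).
  move=> i iT; rewrite dotmulDl dotmulZl.
  by have := he2 t _ i iT; rewrite t0 t2 => /(_ isT); lra.
move=> S1 S2 hc; rewrite leqNgt; apply/negP => rS.
have := he1 t _ (perp S1 + perp S2)%MS; rewrite t0 t1 hc => /(_ isT).
suff U12 : (perp S1 + perp S2)%MS \in Us by move=> /(_ U12).
apply/mapP; exists (S1, S2) => //.
rewrite mem_filter mem_enum andbT /=.
have [+ _] := mxrank_adds_leqif (perp S1) (perp S2).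
rewrite !rank_perp; have := rk_le a S1; have := rk_le a S2; lia.
Qed.

(* Write a generic [c] in the cone as [z1 + z2] with [z1], [z2] in the cone and
   [l z1] minimal. Moving mass from [z1] to [z2] along their minimal faces
   gives the signs of [l] on these faces, whose spans add up to the whole space
   by genericity of [c]. *)
Lemma cone_split T c0 l : rk T = d ->
    (forall i, i \in T -> dotmul c0 (a i) < 0) ->
  exists z1 z2, [/\ cone T z1 /\ cone T z2,
    (rk (ctight T z1) + rk (ctight T z2) <= d)%N,
    (forall w, cone T w -> ctight T z1 \subset ctight T w -> dotmul l w <= 0) &
    (forall w, cone T w -> ctight T z2 \subset ctight T w -> 0 <= dotmul l w)].
Proof.
move=> rT /cone_generic[c Cc gc].
(* The decompositions of [c] form a polyhedron in [z]: the left copy of [I] says that [z] is in the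
   cone, the right copy that [c - z] is. *)
pose a' (s : I + I) := match s with inl i => a i | inr i => - a i end.
pose b' (s : I + I) := match s with inl i => 0 | inr i => - dotmul c (a i) end.
pose T' : {set I + I} :=
  [set s : I + I | (match s with inl i => i | inr i => i end) \in T]%SET.
have P'E z : poly a' T' b' z <-> cone T z /\ cone T (c - z).
  split=> [h|[h1 h2] [i|i]]; rewrite ?inE => //.
  - split=> i iT; first by have := h (inl i); rewrite inE; exact.
    have := h (inr i); rewrite inE /= dotmulNr => /(_ iT).
    by rewrite dotmulBl; lra.
  - exact: h1.
  - by move=> /h2; rewrite dotmulBl /= dotmulNr; lra.
have bd : bounded_dir a' T'.
  move=> w w0; have : ~~ (w <= perp T)%MS by rewrite perp_full.
  move=> /perpP /existsNP[i] /not_implyP[iT] /eqP.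
  rewrite neq_lt => /orP[|] wi; [exists (inr i)|exists (inl i)];
    by rewrite ?inE//= dotmulNr oppr_gt0.
have P0 : poly a' T' b' 0.
  by apply/P'E; split=> [i _|]; rewrite ?dot0mul ?subr0.
have [z1 /P'E[C1 C2] hz1] := poly_max (- l) bd P0.
(* Transferring [e *: w] from [z1] to [c - z1] cannot decrease [l z1]; [e] may be negative, which
   handles the reverse transfer. *)
have mov w : cone T w ->
    forall e : R, cone T (z1 - e *: w) -> cone T (c - z1 + e *: w) ->
    e * dotmul l w <= 0.
  move=> Cw e h1 h2; have Pz : poly a' T' b' (z1 - e *: w).
    by apply/P'E; rewrite opprB addrCA addrC.
  by have := hz1 _ Pz; rewrite dotmulBr !dotmulNl dotmulZr; lra.
exists z1, (c - z1); split => //.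
- have zz := addmx_sub_adds (ctight_perp a T z1) (ctight_perp a T (c - z1)).
  by apply: gc; rewrite addrC subrK in zz.
- move=> w Cw /(cone_sub_small C1)[e e0 Ce].
  have := mov w Cw e Ce; rewrite pmulr_rle0//; apply => i iT.
  rewrite dotmulDl dotmulZl; have := C2 i iT; have := Cw i iT.
  by rewrite -(pmulr_rle0 _ e0) => h1 h2; lra.
- move=> w Cw /(cone_sub_small C2)[e e0 Ce].
  have := mov w Cw (- e); rewrite scaleNr opprK mulNr oppr_le0 pmulr_rge0//.
  apply => // i iT; rewrite dotmulDl dotmulZl.
  have := C1 i iT; have := Cw i iT.
  by rewrite -(pmulr_rle0 _ e0) => h1 h2; lra.
Qed.

End cone_split.

(** * Counting the vertices of the polar body *)

Section polar.
Context {R : realType} {d : nat} {I : finType}.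
Variable a : I -> 'rV[R]_d.
Implicit Types (S T : {set I}) (y z w l c v : 'rV[R]_d).

Notation rk := (rk a).
Notation cone T := (poly a T (fun=> 0)).
Notation ctight T := (tight a T (fun=> 0)).
(* With [a] the generators of [Q]: [ptight y] is the set of generators on the
   supporting hyperplane [<y, x> = 1] of [Q]. *)
Definition polar := poly a [set: I]%SET (fun=> 1).
Definition ptight := tight a [set: I]%SET (fun=> 1).

(** Near [v] the polar coincides with its tangent cone: after a small step along [z] the slack
    constraints stay slack. *)
Lemma polar_lift v z : polar v -> cone (ptight v) z ->
  exists2 y, polar y & ptight y = ctight (ptight v) z.
Proof.
move=> Pv Cz; have [|e e0 he] := @small_scale R I [pred i | i \notin ptight v]
    (fun i => 1 - dotmul v (a i)) (fun i => dotmul z (a i)).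
  move=> i /=; rewrite inE finset.in_setT /= => vi.
  by rewrite subr_gt0 lt_neqAle vi Pv ?finset.in_setT.
have e20 : 0 < e / 2 < e by lra.
exists (v + (e / 2) *: z) => [i _|].
  rewrite dotmulDl dotmulZl; have [iv|iv] := boolP (i \in ptight v).
    by rewrite (tightP iv) gerDl pmulr_rle0 ?Cz// divr_gt0.
  by have := he _ e20 i iv; lra.
apply/setP => i; rewrite inE finset.in_setT /= dotmulDl dotmulZl.
rewrite [RHS]inE; have [iv|iv] := boolP (i \in ptight v).
  rewrite (tightP iv) -subr_eq0 addrAC subrr add0r mulf_eq0.
  by rewrite gt_eqF ?divr_gt0.
by have := he _ e20 i iv; apply: contraTF => /eqP; lra.
Qed.

Lemma cone_diff v y : polar y -> cone (ptight v) (y - v).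
Proof.
by move=> Py i iv; rewrite dotmulBl (tightP iv) subr_le0 Py ?finset.in_setT.
Qed.

Lemma ctight_diff v y S : S \subset ptight v -> S \subset ptight y ->
  S \subset ctight (ptight v) (y - v).
Proof.
move=> /fintype.subsetP Sv /fintype.subsetP Sy; apply/fintype.subsetP => i iS.
by rewrite inE Sv//= dotmulBl (tightP (Sv i iS)) (tightP (Sy i iS)) subrr.
Qed.

(* A face of the polar body is encoded by its tight constraints: those of rank
   [r] are its faces of dimension [d - r], and also the sets of generators in the
   faces of [Q] of dimension [r - 1]. *)
Definition polar_faces (r : nat) : {set {set I}} :=
  [set S : {set I} | `[< exists2 y, polar y & ptight y = S >] && (rk S == r)]%SET.

(** A face together with a sign: with [true], [v] maximizes [l] on the face encoded by [p.1]; with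
    [false], it minimizes [l] there. *)
Definition optimal_at l v (p : {set I} * bool) :=
  p.1 \subset ptight v /\ forall y, polar y -> p.1 \subset ptight y ->
    (-1) ^+ p.2 * dotmul l v <= (-1) ^+ p.2 * dotmul l y.

Lemma cone_polar_face v z r : polar v -> cone (ptight v) z ->
  rk (ctight (ptight v) z) = r -> ctight (ptight v) z \in polar_faces r.
Proof.
move=> Pv Cz rz; rewrite inE rz eqxx andbT; apply/asboolP.
exact: polar_lift.
Qed.

(** The two faces given by [cone_split] have ranks of sum at most [d], hence at most [2 r]. Either
    one rank is below [r], and that face has two subfaces of rank [r], or both equal [r], which
    gives one face for each sign. For [r = d] the vertex itself counts with both signs. *)
Lemma two_optimal_faces v l r : polar v -> rk (ptight v) = d ->
    (uphalf d <= r <= d)%N ->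
  exists p1 p2, [/\ p1 != p2, p1.1 \in polar_faces r, p2.1 \in polar_faces r,
    optimal_at l v p1 & optimal_at l v p2].
Proof.
move=> Pv vd /andP[dr]; rewrite leq_eqVlt => /orP[/eqP rd|rd].
  have pv : ptight v \in polar_faces r.
    by rewrite inE vd rd eqxx andbT; apply/asboolP; exists v.
  exists (ptight v, true), (ptight v, false).
  split=> //; first by apply/eqP => -[].
  - by split => // y Py /(vertex_inj vd) ->.
  - by split => // y Py /(vertex_inj vd) ->.
have [|z1 [z2 [[C1 C2] r12 l1 l2]]] := @cone_split R d I a (ptight v) (- v) l vd.
  by move=> i iv; rewrite dotmulNl (tightP iv) oppr_lt0.
have opt1 S : S \subset ptight v -> ctight (ptight v) z1 \subset S ->
    optimal_at l v (S, true).
  move=> Sv zS; split => // y Py Sy.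
  have := l1 _ (@cone_diff v y Py) (fintype.subset_trans zS (ctight_diff Sv Sy)).
  by rewrite dotmulBr expr1 !mulN1r; lra.
have opt2 S : S \subset ptight v -> ctight (ptight v) z2 \subset S ->
    optimal_at l v (S, false).
  move=> Sv zS; split => // y Py Sy.
  have := l2 _ (@cone_diff v y Py) (fintype.subset_trans zS (ctight_diff Sv Sy)).
  by rewrite dotmulBr expr0 !mul1r; lra.
have [r1|r1] := ltnP (rk (ctight (ptight v) z1)) r.
  have [|w1 [w2 [[D1 D2] [s1 s2] q1 q2 n12]]] := cone_chain2 vd C1 (r := r).
    by rewrite r1.
  exists (ctight (ptight v) w1, true), (ctight (ptight v) w2, true); split.
  - by apply: contra n12 => /eqP[->].
  - exact: cone_polar_face.
  - exact: cone_polar_face.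
  - by apply: opt1 => //; exact: tight_sub.
  - by apply: opt1 => //; exact: tight_sub.
have [r2|r2] := ltnP (rk (ctight (ptight v) z2)) r.
  have [|w1 [w2 [[D1 D2] [s1 s2] q1 q2 n12]]] := cone_chain2 vd C2 (r := r).
    by rewrite r2.
  exists (ctight (ptight v) w1, false), (ctight (ptight v) w2, false); split.
  - by apply: contra n12 => /eqP[->].
  - exact: cone_polar_face.
  - exact: cone_polar_face.
  - by apply: opt2 => //; exact: tight_sub.
  - by apply: opt2 => //; exact: tight_sub.
exists (ctight (ptight v) z1, true), (ctight (ptight v) z2, false); split.
- by apply/eqP => -[].
- by apply: cone_polar_face => //; lia.
- by apply: cone_polar_face => //; lia.
- by apply: opt1 => //; exact: tight_sub.
- by apply: opt2 => //; exact: tight_sub.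
Qed.

(** Each vertex has two signed faces of rank [r], and a signed face has at most one optimal vertex
    when [l] separates the vertices. Both sides of the count carry a factor 2, which cancels. *)
Lemma leq_card_vertices r : (uphalf d <= r <= d)%N ->
  (#|polar_faces d| <= #|polar_faces r|)%N.
Proof.
move=> hr.
pose vert S := xget 0 [set v | polar v /\ ptight v = S].
have vertP S : S \in polar_faces d ->
    [/\ polar (vert S), ptight (vert S) = S & rk S = d].
  rewrite inE => /andP[/asboolP[v Pv vS] /eqP rS].
  by rewrite /vert; case: xgetP => [w _ [] //|/(_ v)] [].
pose Us := [seq kermx (vert X.1 - vert X.2)^T | X : {set I} * {set I}
  <- enum {: {set I} * {set I}} & vert X.1 != vert X.2].
have [|l _ hl] := @subspace_avoid R d Us 1%:M.
  move=> U /mapP[X]; rewrite mem_filter => /andP[XX _] ->.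
  apply/negP => /(submx_trans (submx1 (vert X.1 - vert X.2))).
  by rewrite sub_kermx_dotmul dotmul_eq0 subr_eq0 (negbTE XX).
have linj S1 S2 : dotmul l (vert S1) = dotmul l (vert S2) -> vert S1 = vert S2.
  move=> h; apply/eqP; apply: contraT => n12.
  have : kermx (vert S1 - vert S2)^T \in Us.
    by apply/mapP; exists (S1, S2) => //; rewrite mem_filter n12 mem_enum.
  by move=> /hl; rewrite sub_kermx_dotmul dotmulBr h subrr eqxx.
have /choice[f hf] S : exists p : ({set I} * bool) * ({set I} * bool),
    S \in polar_faces d -> [/\ p.1 != p.2, p.1.1 \in polar_faces r,
     p.2.1 \in polar_faces r, optimal_at l (vert S) p.1 &
     optimal_at l (vert S) p.2].
  have [SV|SV] := boolP (S \in polar_faces d); last by exists ((S, true), (S, true)).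
  have [Pv vS rS] := vertP S SV.
  have [||p1 [p2 hp]] := @two_optimal_faces (vert S) l r Pv; rewrite ?vS//.
  by exists (p1, p2).
pose g (x : {set I} * bool) := if x.2 then (f x.1).1 else (f x.1).2.
have gP x : x.1 \in polar_faces d ->
    (g x).1 \in polar_faces r /\ optimal_at l (vert x.1) (g x).
  by move=> /hf[_ ? ? ? ?]; rewrite /g; case: x.2.
have ginj : {in finset.setX (polar_faces d) [set: bool]%SET &, injective g}.
  move=> [S s] [S' s']; rewrite !finset.in_setX !finset.in_setT !andbT /= => SV SV' gg.
  have [_ [vS oS]] := gP (S, s) SV; have [_ [vS' oS']] := gP (S', s') SV'.
  have [Pv vE rS] := vertP S SV; have [Pv' vE' rS'] := vertP S' SV'.
  rewrite -gg /= in vS' oS' oS vS.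
  have SS : S = S'.
    (* Each of the two vertices is optimal on the common face, which contains the other, so [l]
       takes the same value at both. *)
    rewrite -vE -vE'; congr ptight; apply: linj.
    have := oS _ Pv' vS'; have := oS' _ Pv vS.
    by case: (g (S, s)).2; rewrite ?expr1 ?expr0 ?mul1r ?mulN1r; lra.
  move: gg => {vS vS' oS oS'}; rewrite /g -SS /=; have [n12 _ _ _ _] := hf S SV.
  by case: s s' => [] [] //= e12; move: n12; rewrite e12 eqxx.
have := card_in_imset ginj; rewrite finset.cardsX cardsT card_bool => gcard.
have : (#|g @: finset.setX (polar_faces d) [set: bool]%SET| <=
    #|finset.setX (polar_faces r) [set: bool]%SET|)%N.
  apply/subset_leq_card/fintype.subsetP => p /imsetP[[S s]].
  rewrite finset.in_setX finset.in_setT andbT => SV ->.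
  have [+ _] := gP (S, s) SV; case: (g (S, s)) => S' s' rS'.
  by rewrite finset.in_setX finset.in_setT andbT.
by rewrite gcard finset.cardsX cardsT card_bool leq_pmul2r.
Qed.

End polar.

(** * Polytopes containing the unit ball *)

Section enorm_theory.
Context {R : realType} {d : nat}.
Implicit Types (x y : 'rV[R]_d) (t : R).

Lemma enorm_ge0 x : 0 <= enorm x.
Proof. exact: sqrtr_ge0. Qed.

Lemma sqr_enorm x : enorm x ^+ 2 = dotmul x x.
Proof. by rewrite sqr_sqrtr// dotmul_ge0. Qed.

Lemma enormZ t x : enorm (t *: x) = `|t| * enorm x.
Proof.
rewrite /enorm dotmulZl dotmulZr mulrA -expr2 sqrtrM ?sqr_ge0//.
by rewrite sqrtr_sqr.
Qed.

Lemma enorm_eq0 x : (enorm x == 0) = (x == 0).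
Proof. by rewrite -dotmul_eq0 -sqr_enorm sqrf_eq0. Qed.

Lemma enorm0 : enorm (0 : 'rV[R]_d) = 0.
Proof. by apply/eqP; rewrite enorm_eq0. Qed.

Lemma enorm_gt0 x : (0 < enorm x) = (x != 0).
Proof. by rewrite lt_neqAle enorm_ge0 andbT eq_sym enorm_eq0. Qed.

Lemma enorm_normalize x : x != 0 -> enorm ((enorm x)^-1 *: x) = 1.
Proof.
move=> x0; rewrite enormZ gtr0_norm ?invr_gt0 ?enorm_gt0// mulVf//.
by rewrite enorm_eq0.
Qed.

Lemma enorm_le1 x : (enorm x <= 1) = (dotmul x x <= 1).
Proof. by rewrite -sqr_enorm -[1 in RHS](expr1n _ 2) ler_pXn2r ?nnegrE ?enorm_ge0. Qed.

End enorm_theory.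

(** * Convex hulls, separation and affine sets *)

Section convex_hull_theory.
Context {R : realType} {d : nat}.
Implicit Types (A C : set 'rV[R]_d) (x y z p n : 'rV[R]_d) (t c : R).

Lemma convex_hull_ind A C :
    (forall x y t, 0 < t < 1 -> C x -> C y -> C (t *: x + (1 - t) *: y)) ->
  A `<=` C -> convex_hull A `<=` C.
Proof.
move=> hC; apply: smallest_sub; apply/convex_setW => x y; rewrite !inE => Cx Cy.
by move=> k k0 k1; rewrite inE; apply: hC => //; rewrite k0.
Qed.

Lemma convex_hull_conv A x y t : 0 <= t <= 1 -> convex_hull A x ->
  convex_hull A y -> convex_hull A (t *: x + (1 - t) *: y).
Proof.
move=> /andP[t0 t1] hx hy C [cC AC].
have ti : Itv.spec (@Itv.num_sem R) (Itv.Real `[0%Z, 1%Z]) t.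
  by apply/andP; split; [exact: ger0_real|rewrite in_itv/= t0].
have := cC x y (Itv.mk ti); rewrite !inE; apply; [exact: hx|exact: hy].
Qed.

Lemma dotmul_hull_le A n c : (forall x, A x -> dotmul n x <= c) ->
  forall x, convex_hull A x -> dotmul n x <= c.
Proof.
move=> h; apply: convex_hull_ind => // x y t /andP[t0 t1] hx hy.
rewrite dotmulDr !dotmulZr.
have -> : c = t * c + (1 - t) * c by rewrite -mulrDl addrC subrK mul1r.
by rewrite lerD// ler_pM2l// subr_gt0.
Qed.

Lemma sqr_conv x y t : dotmul (t *: x + (1 - t) *: y) (t *: x + (1 - t) *: y) =
  t * dotmul x x + (1 - t) * dotmul y y - t * (1 - t) * dotmul (x - y) (x - y).
Proof.
by rewrite !(dotmulDl, dotmulDr, dotmulZl, dotmulZr, dotmulNl, dotmulNr)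
  (dotmulC y x); ring.
Qed.

Lemma convex_hull_bounded A c : (forall x, A x -> dotmul x x <= c) ->
  forall x, convex_hull A x -> dotmul x x <= c.
Proof.
move=> h; apply: convex_hull_ind => // x y t /andP[t0 t1] hx hy.
rewrite sqr_conv.
have t1' : 0 < 1 - t by rewrite subr_gt0.
have := mulr_ge0 (mulr_ge0 (ltW t0) (ltW t1')) (dotmul_ge0 (x - y)).
have : t * dotmul x x <= t * c by rewrite ler_pM2l.
have : (1 - t) * dotmul y y <= (1 - t) * c by rewrite ler_pM2l.
lra.
Qed.

Lemma ball_support A n c : unit_ball R d `<=` convex_hull A ->
  (forall x, convex_hull A x -> dotmul n x <= c) -> enorm n <= c.
Proof.
move=> BA h; have [->|n0] := eqVneq n 0.
  have := h 0; rewrite dotmul0 enorm0; apply; apply: BA.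
  by rewrite /unit_ball /= enorm0.
have := h ((enorm n)^-1 *: n); rewrite dotmulZr -sqr_enorm expr2 mulKf ?enorm_eq0//.
by apply; apply: BA; rewrite /unit_ball /= enorm_normalize.
Qed.

(* An approximate nearest point [p] of the hull to [x] is enough for strict
   separation, which avoids any compactness argument. *)
Lemma separation A x e B : unit_ball R d `<=` convex_hull A ->
    (forall z, convex_hull A z -> dotmul z z <= B) ->
    0 < e -> (forall z, convex_hull A z -> e <= dotmul (x - z) (x - z)) ->
  exists2 n, forall z, convex_hull A z -> dotmul n z <= 1 & 1 < dotmul n x.
Proof.
move=> BA hB e0 he.
have Q0 : convex_hull A 0 by apply: BA; rewrite /unit_ball/= enorm_le1 dotmul0.
have B0 : 0 <= B by have := hB 0 Q0; rewrite dotmul0.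
pose D := [set dotmul (x - z) (x - z) | z in convex_hull A].
have infD : has_inf D.
  split; first by exists (dotmul (x - 0) (x - 0)), 0.
  by exists e => _ [z Qz <-]; exact: he.
have eD : e <= inf D by apply: lb_le_inf; [case: infD|move=> _ [z Qz <-]; exact: he].
(* Two points of the hull have squared distance at most [4 * B], so [t] times it is at most [e]. *)
pose t : R := Num.min 1 (e / (4 * B + 1)).
have K0 : 0 < 4 * B + 1 by lra.
have t0 : 0 < t by rewrite /t lt_min ltr01 divr_gt0.
have t1 : t <= 1 by rewrite /t ge_min lexx.
have tK : t * (4 * B + 1) <= e by rewrite -ler_pdivlMr// /t ge_min lexx orbT.
clearbody t.
have [|_ [p Qp <-] hp] := inf_adherent (eps := t * e / 2) _ infD.
  by rewrite divr_gt0// mulr_gt0.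
have nn := he p Qp.
set n := x - p in hp nn; have nE : n = x - p by []; clearbody n.
(* Compare [p] with the point [t z + (1 - t) p]: the error [t e / 2] in the infimum and the
   quadratic term, at most [t e], bound [2 t <n, z - p>] by [3 t e / 2]. As [<n, n> >= e], the
   margin [3 / 4 * e] still separates [x]. *)
have var z : convex_hull A z -> dotmul n z <= dotmul n p + 3 / 4 * e.
  move=> Qz; have Qtz : convex_hull A (t *: z + (1 - t) *: p).
    by apply: convex_hull_conv; rewrite ?(ltW t0).
  have : inf D <= dotmul (x - (t *: z + (1 - t) *: p)) (x - (t *: z + (1 - t) *: p)).
    by apply: ge_inf; [case: infD|exists (t *: z + (1 - t) *: p)].
  have -> : x - (t *: z + (1 - t) *: p) = n - t *: (z - p).
    by rewrite nE; apply/rowP => i; rewrite !mxE; ring.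
  have [q qE] : exists q, q = z - p by exists (z - p).
  rewrite -qE.
  rewrite dotmulBl !dotmulBr !(dotmulZr, dotmulZl) (dotmulC q n) => h1.
  have zp : dotmul q q <= 4 * B.
    rewrite qE; have := dotmul_ge0 (z + p); have := hB z Qz; have := hB p Qp.
    rewrite !(dotmulDl, dotmulDr, dotmulNl, dotmulNr) (dotmulC p z); lra.
  have : t * (t * dotmul q q) <= t * e.
    rewrite ler_pM2l//; apply: le_trans tK; rewrite ler_pM2l//; lra.
  move=> h2; have : t * dotmul n q <= t * (3 / 4 * e) by lra.
  by rewrite ler_pM2l// qE dotmulBr; lra.
have n0 : n != 0 by rewrite -dotmul_eq0; apply/eqP; lra.
pose c := dotmul n p + 3 / 4 * e.
have c0 : 0 < c.
  by apply: lt_le_trans (ball_support BA var); rewrite enorm_gt0.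
exists (c^-1 *: n).
  by move=> z Qz; rewrite dotmulZl mulrC ler_pdivrMr// mul1r; exact: var.
rewrite dotmulZl mulrC ltr_pdivlMr// mul1r /c -(subrK p x) -nE dotmulDr.
lra.
Qed.

End convex_hull_theory.

(** [x + w1 + w2] is the midpoint of [x + 2 w1] and [x + 2 w2]. *)
Lemma affine_setD (R : realType) (d : nat) (H : set 'rV[R]_d) x : affine_set H ->
    H x -> forall w1 w2, H (x + w1) -> H (x + w2) -> H (x + (w1 + w2)).
Proof.
move=> aH Hx.
have dbl w : H (x + w) -> H (x + 2 *: w).
  move=> hw; have := aH _ _ 2 hw Hx; congr H.
  by apply/rowP => i; rewrite !mxE; ring.
move=> w1 w2 h1 h2; have := aH _ _ (2^-1) (dbl _ h1) (dbl _ h2); congr H.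
by apply/rowP => i; rewrite !mxE; field.
Qed.

Lemma affine_set_sum (R : realType) (d : nat) (H : set 'rV[R]_d) x (I : finType)
    (P : pred I) (c : I -> R) (w : I -> 'rV[R]_d) : affine_set H -> H x ->
    (forall i, P i -> H (x + w i)) -> H (x + \sum_(i | P i) c i *: w i).
Proof.
move=> aH Hx h; elim/big_rec: _ => [|i y Pi Hy]; first by rewrite addr0.
apply: (affine_setD aH Hx) => //; have := aH _ _ (c i) (h i Pi) Hx; congr H.
by apply/rowP => j; rewrite !mxE; ring.
Qed.

(** Translates the row spaces used for ranks into the [{vspace}] required by [has_dim]. *)
Lemma rowspace_vspace (R : realType) (m d : nat) (W : 'M[R]_(m, d)) :
  exists2 V : {vspace 'rV[R]_d}, \dim V = \rank W &
    forall x, (x \in V) = (x <= W)%MS.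
Proof.
pose B := row_base W; pose X := [tuple row i B | i < \rank W].
have sumX (k : 'I_(\rank W) -> R) :
    \sum_i k i *: X`_i = (\row_i k i) *m B.
  rewrite mulmx_sum_row; apply: eq_bigr => i _.
  by rewrite !mxE -tnth_nth tnth_mktuple.
have fX : free X.
  apply/freeP => k; rewrite sumX => k0 i.
  have : (\row_i k i) *m B = 0 *m B by rewrite k0 mul0mx.
  by move=> /(row_free_inj (row_base_free W))/rowP/(_ i); rewrite !mxE.
exists <<X>>%VS; first by move: fX; rewrite /free size_tuple => /eqP.
move=> x; have -> : (x <= W)%MS = (x <= B)%MS by rewrite eq_row_base.
apply/idP/idP => [xX|/submxP[u ->]].
  by rewrite (coord_span xX) sumX submxMl.
have -> : u = \row_i u 0 i by apply/rowP => i; rewrite mxE.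
rewrite -sumX; apply: memv_suml => i _; apply/memvZ/memv_span.
by rewrite mem_nth// size_tuple.
Qed.

(** * Faces of the polytope dual to faces of its polar *)

Section polytope_faces.
Context {R : realType} {d : nat} {I : finType}.
Variable a : I -> 'rV[R]_d.
Implicit Types (S T : {set I}) (x y z v n : 'rV[R]_d).

Notation Q := (convex_hull (range a)).
Notation rk := (rk a).
Notation polar := (polar a).
Notation ptight := (ptight a).

Lemma hull_vertex i : Q (a i).
Proof. by move=> C [_ h]; exact/h/imageT. Qed.

Lemma polarP y : polar y <-> forall x, Q x -> dotmul y x <= 1.
Proof.
split=> [Py|h i _]; last by apply: h; exact: hull_vertex.
by apply: dotmul_hull_le => _ [i _ <-]; apply: Py; rewrite finset.in_setT.
Qed.

Definition exposed y := Q `&` [set x | dotmul y x = 1].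

Lemma exposed_span y : polar y -> forall x, exposed y x ->
  (x <= gens a (ptight y))%MS.
Proof.
move=> Py x [Qx yx].
(* This form passes through [convex_hull_ind]: a proper convex combination reaches the value 1 only
   if both points do. *)
suff : dotmul y x <= 1 /\ (dotmul y x = 1 -> (x <= gens a (ptight y))%MS).
  by move=> [_ /(_ yx)].
move: x Qx {yx}; apply: convex_hull_ind.
  move=> x z t /andP[t0 t1] [x1 hx] [z1 hz]; rewrite dotmulDr !dotmulZr.
  have h1 : t * dotmul y x <= t by rewrite ger_pMr.
  have h2 : (1 - t) * dotmul y z <= 1 - t by rewrite ger_pMr// subr_gt0.
  split=> [|h]; first by lra.
  apply: addmx_sub; apply: scalemx_sub.
    by apply: hx; apply: (mulfI (lt0r_neq0 t0)); lra.
  by apply: hz; apply: (mulfI (lt0r_neq0 (_ : 0 < 1 - t))); lra.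
move=> _ [i _ <-]; split; first by apply: Py; rewrite finset.in_setT.
by move=> yi; apply: gens_row; rewrite inE finset.in_setT yi eqxx.
Qed.

Lemma exposed_vertex y i : polar y -> (exposed y (a i)) <-> i \in ptight y.
Proof.
move=> Py; rewrite inE finset.in_setT /=; split=> [[_ ->]|/eqP yi]; first exact: eqxx.
by split => //; exact: hull_vertex.
Qed.

(** The direction space of the face is the part of the span of its generators orthogonal to [y]; one
    dimension is lost because [y] is 1 on these generators. *)
Lemma exposed_dim y k : polar y -> rk (ptight y) = k.+1 -> has_dim (exposed y) k.
Proof.
move=> Py ry; pose S := ptight y.
have [/eqP S0|/finset.set0Pn[i0 i0S]] := boolP (S == finset.set0).
  move: ry; rewrite -/S /rk /gens S0; set M := (X in \rank X).
  have -> : M = 0 by apply/matrixP => i j; rewrite !mxE finset.in_set0 mxE.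
  by rewrite mxrank0.
pose x := a i0.
have [V dV VP] := rowspace_vspace (gens a S :&: kermx y^T)%MS.
exists x, V; split.
  rewrite dV; have := mxrank_sum_cap (gens a S) (kermx y^T).
  have := rank_leq_col (gens a S + kermx y^T)%MS.
  have : (\rank (gens a S :&: kermx y^T) < \rank (gens a S))%N.
    suff : (gens a S :&: kermx y^T < gens a S)%MS by rewrite ltmxErank => /andP[].
    rewrite /ltmx capmxSl/=; apply/negP => h.
    have := submx_trans (gens_row a i0S) h.
    by rewrite sub_cap_kermx dotmulC (tightP i0S) oner_eq0 andbF.
  rewrite -/(rk S) ry mxrank_ker; have := rank_leq_col y^T; lia.
have Hx : exposed y x by apply/exposed_vertex.
apply/seteqP; split.
  apply: smallest_sub.
    move=> u v t /=; rewrite !VP => hu hv.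
    have -> : t *: u + (1 - t) *: v - x = t *: (u - x) + (1 - t) *: (v - x).
      by apply/rowP => i; rewrite !mxE; ring.
    by rewrite addmx_sub ?scalemx_sub.
  move=> z Hz /=; rewrite VP sub_cap_kermx dotmulC dotmulBr.
  rewrite addmx_sub ?eqmx_opp ?exposed_span//=.
  by case: Hz => _ ->; case: Hx => _ ->; rewrite subrr.
move=> z /=; rewrite VP sub_cap_kermx => /andP[/submxP[u zE] /eqP yz] H [aH FH].
rewrite -(subrK x z) addrC.
have {}zE : z - x = \sum_(i in S) u 0 (enum_rank i) *: a i.
  rewrite zE mulmx_sum_row (reindex (@enum_rank I)); last first.
    by apply: onW_bij; exact: enum_rank_bij.
  rewrite [RHS]big_mkcond /=; apply: eq_bigr => i _.
  have -> : row (enum_rank i) (gens a S) = if i \in S then a i else 0.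
    by apply/rowP => j; rewrite !mxE enum_rankK.
  by case: ifP => //; rewrite scaler0.
(* Pair [z - x] with [y], which equals 1 on each tight generator; coefficients of sum 0 turn a
   linear combination into an affine one. *)
have sum0 : \sum_(i in S) u 0 (enum_rank i) = 0.
  transitivity (dotmul (z - x) y) => //.
  rewrite zE dotmulC dotmul_sumr; apply: eq_bigr => i iS.
  by rewrite dotmulZr (tightP iS) mulr1.
have -> : z - x = \sum_(i in S) u 0 (enum_rank i) *: (a i - x).
  under eq_bigr do rewrite scalerBr.
  by rewrite sumrB -zE -scaler_suml sum0 scale0r subr0.
apply: affine_set_sum => //; first exact: FH.
by move=> i iS; rewrite addrC subrK; apply: FH; apply/exposed_vertex.
Qed.

(** A tight set is recovered from its exposed face as the set of generators lying in it, so distinct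
    tight sets of rank [k + 1] give distinct k-faces. *)
Lemma card_polar_faces k M : (k_faces k Q #<= `I_M)%card ->
  (#|polar_faces a k.+1| <= M)%N.
Proof.
move=> hM; pose F S := exposed (xget 0 [set y | polar y /\ ptight y = S]).
have FP S : S \in polar_faces a k.+1 ->
    exists y, [/\ polar y, ptight y = S, rk S = k.+1 & F S = exposed y].
  rewrite inE => /andP[/asboolP[y Py yS] /eqP rS].
  by rewrite /F; case: xgetP => [z _ [Pz zS]|/(_ y)] //; [exists z|case].
have Finj : {in polar_faces a k.+1 &, injective F}.
  move=> S S' /FP[y [Py <- _ ->]] /FP[y' [Py' <- _ ->]] e.
  by apply/setP => i; apply/idP/idP => /exposed_vertex;
    [rewrite e|rewrite -e] => /(_ _)?; apply/exposed_vertex => //; auto.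
pose f (n : nat) := F (nth finset.set0 (enum (polar_faces a k.+1)) n).
have fP (n : nat) : `I_#|polar_faces a k.+1| n ->
    nth finset.set0 (enum (polar_faces a k.+1)) n \in polar_faces a k.+1.
  by move=> nN; rewrite -mem_enum mem_nth// -cardE.
rewrite -card_le_II; apply: card_le_trans hM.
have fI : {in `I_#|polar_faces a k.+1| &, injective f}.
  move=> m n; rewrite !inE => mN nN /(Finj _ _ (fP _ mN) (fP _ nN)) /eqP.
  by rewrite nth_uniq ?enum_uniq -?cardE// => /eqP.
rewrite -(card_le_eql (inj_card_eq fI)); apply: subset_card_le.
move=> _ [n nN <-]; have [y [Py yS ry Fy]] := FP _ (fP _ nN).
rewrite /f Fy; split; last by apply: exposed_dim => //; rewrite yS.
exists y, 1; split=> //; last exact/polarP.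
(* For [y = 0] no constraint is tight, so the rank would be 0 and not [k + 1]. *)
apply/eqP => y0; move: ry; rewrite -yS y0 /rk /gens.
set M' := (X in \rank X); suff -> : M' = 0 by rewrite mxrank0.
apply/matrixP => i j; rewrite !mxE inE finset.in_setT dot0mul eq_sym oner_eq0.
by rewrite mxE.
Qed.

End polytope_faces.

(** * The radial function as the inverse of a gauge *)

Section gauge.
Context {R : realType} {d : nat}.
Implicit Types (u v x : 'rV[R]_d) (vs : seq 'rV[R]_d).

Definition gauge vs u : R := \big[Num.max/0]_(v <- vs) dotmul v u.

Lemma dotmul_le_gauge vs u v : v \in vs -> dotmul v u <= gauge vs u.
Proof.
rewrite /gauge; elim: vs => // w vs ih.
rewrite in_cons big_cons le_max => /orP[/eqP ->|/ih ->]; rewrite ?lexx ?orbT//.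
Qed.

Lemma gauge_gtP vs u c : 0 <= c ->
  c < gauge vs u <-> exists2 v, v \in vs & c < dotmul v u.
Proof.
move=> c0; split=> [|[v vvs]]; last first.
  by move=> /lt_le_trans; apply; exact: dotmul_le_gauge.
rewrite /gauge; elim: vs => [|w vs ih]; first by rewrite big_nil ltNge c0.
rewrite big_cons lt_max => /orP[cw|/ih[v vvs cv]].
  by exists w; rewrite ?mem_head.
by exists v => //; rewrite in_cons vvs orbT.
Qed.

End gauge.

Section radial_polytope.
Context {R : realType} {d : nat} {I : finType}.
Variable a : I -> 'rV[R]_d.
Hypothesis ball_sub : unit_ball R d `<=` convex_hull (range a).
Implicit Types (S T : {set I}) (x y z u v n : 'rV[R]_d).

Notation Q := (convex_hull (range a)).

Definition polar_vertex S := xget 0 [set y | polar a y /\ ptight a y = S].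

Definition polar_vertices := [seq polar_vertex X | X <- enum (polar_faces a d)].

Lemma polar_vertex_polar v : v \in polar_vertices -> polar a v.
Proof.
move=> /mapP[S]; rewrite mem_enum inE => /andP[/asboolP[y Py yS] _] ->.
by rewrite /polar_vertex; case: xgetP => [z _ []|/(_ y) []].
Qed.

Lemma bounded_dir_hull : bounded_dir a [set: I]%SET.
Proof.
move=> w w0; apply/exists2P; apply: contrapT => /forallNP no.
suff : enorm w <= 0 by rewrite leNgt enorm_gt0 w0.
apply: (ball_support ball_sub); apply: dotmul_hull_le => _ [i _ <-].
by rewrite leNgt; apply/negP => wi; apply: (no i); rewrite finset.in_setT.
Qed.

Lemma polar_le_vertex u y : polar a y ->
  exists2 v, v \in polar_vertices & dotmul y u <= dotmul v u.
Proof.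
move=> Py; have [v [Pv vd uv]] := poly_vertex u bounded_dir_hull Py.
exists v; last by rewrite !(dotmulC _ u).
have vV : ptight a v \in polar_faces a d.
  by rewrite inE vd eqxx andbT; apply/asboolP; exists v.
apply/mapP; exists (ptight a v); first by rewrite mem_enum.
rewrite /polar_vertex; case: xgetP => [z _ [Pz zv]|/(_ v)].
  by apply: (vertex_inj (b := fun=> 1) vd); rewrite -/(ptight a z) zv.
by move=> /(_ (conj Pv erefl)).
Qed.

Lemma gauge_gt0 u : enorm u = 1 -> 0 < gauge polar_vertices u.
Proof.
move=> u1; have uu : dotmul u u = 1 by rewrite -sqr_enorm u1 expr1n.
have [//|e e0 he] := @small_scale R I predT (fun=> 1) (fun i => dotmul u (a i)).
have [|v vV] := @polar_le_vertex u ((e / 2) *: u).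
  by move=> i _; rewrite dotmulZl; apply/ltW/he => //; lra.
rewrite dotmulZl uu mulr1 => h; apply: lt_le_trans (dotmul_le_gauge u vV).
by apply: lt_le_trans h; lra.
Qed.

(** The polar vertices bound every admissible [l] by the inverse gauge. If the supremum were
    smaller, a point [s u] in between would be separated from [Q] by some [y] of the polar, and a
    vertex at least as good as [y] would contradict [s < g^-1]. *)
Lemma radial_gauge u : enorm u = 1 ->
  radial Q u = (gauge polar_vertices u)^-1.
Proof.
move=> u1; have uu : dotmul u u = 1 by rewrite -sqr_enorm u1 expr1n.
have g0 := gauge_gt0 u1; set g := gauge _ u in g0 *.
pose E := [set l : R | 0 <= l /\ Q (l *: u)].
have E0 : E 0.
  split => //; apply: ball_sub; rewrite scale0r /unit_ball/=.
  by rewrite enorm_le1 dot0mul.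
have ubE : ubound E g^-1.
  move=> l [l0 Ql]; rewrite -[g^-1]mul1r ler_pdivlMr//.
  have [->|ln0] := eqVneq l 0; first by rewrite mul0r.
  have l0' : 0 < l by rewrite lt_neqAle eq_sym ln0.
  rewrite mulrC -ler_pdivlMr// mul1r leNgt; apply/negP.
  rewrite gauge_gtP ?invr_ge0// => -[v vV].
  rewrite -[l^-1]mul1r ltr_pdivrMr//; apply/negP; rewrite -leNgt mulrC -dotmulZr.
  by have /polarP := polar_vertex_polar vV; exact.
have supE : has_sup E by split; [exists 0|exists g^-1].
rewrite /radial -/E; apply/eqP; rewrite eq_le ge_sup//; last by exists 0.
rewrite leNgt; apply/negP => Eg.
have sE0 : 0 <= sup E by apply: ub_le_sup => //; case: supE.
pose s := (sup E + g^-1) / 2; pose s' := (sup E + s) / 2.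
have [Es' s's sg] : [/\ sup E < s', s' < s & s < g^-1] by split; rewrite /s' /s; lra.
have s0 : 0 < s by lra.
have Qs' : ~ Q (s' *: u).
  move=> Qs'; suff : s' <= sup E by lra.
  by apply: ub_le_sup; [case: supE|split => //; lra].
pose t := s' / s.
have t0 : 0 < t by rewrite divr_gt0//; lra.
have t1 : t < 1 by rewrite ltr_pdivrMr// mul1r.
have ts : t * s = s' by rewrite divfK// gt_eqF.
clearbody t s s'.
(* If a point [z] of [Q] were this close to [s u], then [s' u] would be a convex combination of [z]
   and a point [b] of the unit ball, hence in [Q]. *)
pose e := ((1 - t) / t) ^+ 2.
have e0 : 0 < e by rewrite exprn_gt0// divr_gt0// subr_gt0.
have hB : forall z, Q z -> dotmul z z <= \sum_i dotmul (a i) (a i).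
  apply: convex_hull_bounded => _ [i _ <-]; rewrite (bigD1 i)//= lerDl.
  by apply: sumr_ge0 => j _; exact: dotmul_ge0.
have [|y Qy ysu] := separation (x := s *: u) ball_sub hB e0.
  move=> z Qz; rewrite leNgt; apply/negP => he; apply: Qs'.
  pose b := (t / (1 - t)) *: (s *: u - z).
  have -> : s' *: u = t *: z + (1 - t) *: b.
    apply/rowP => i; rewrite -ts !mxE; field.
    by rewrite subr_eq0 gt_eqF.
  apply: convex_hull_conv => //; first by rewrite !ltW.
  apply: ball_sub; rewrite /unit_ball/= enorm_le1 /b dotmulZl dotmulZr mulrA -expr2.
  move: he; rewrite /e => /ltW.
  rewrite -[(1 - t) / t]invrK invf_div exprVn => he.
  by rewrite mulrC -ler_pdivlMr ?mul1r// exprn_gt0// divr_gt0// subr_gt0.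
have Py : polar a y by apply/polarP.
have [v vV yv] := polar_le_vertex u Py.
move: ysu; rewrite dotmulZr => ysu.
have := dotmul_le_gauge u vV; rewrite -/g => vg.
have : s * g < 1 by rewrite -ltr_pdivlMr ?mul1r.
have : s * dotmul y u <= s * g by rewrite ler_pM2l//; lra.
lra.
Qed.

Lemma gauge_le1 u : enorm u = 1 -> gauge polar_vertices u <= 1.
Proof.
move=> u1; rewrite leNgt; apply/negP => /gauge_gtP-/(_ ler01)[v /polar_vertex_polar].
move=> /polarP/(_ u) h; rewrite ltNge h//; apply: ball_sub.
by rewrite /unit_ball/= u1.
Qed.

Lemma enorm_polar v : polar a v -> enorm v <= 1.
Proof. by move=> /polarP; exact: ball_support. Qed.

Lemma gauge_lb : exists2 K : R, 0 < K &
  forall u, enorm u = 1 -> K <= gauge polar_vertices u.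
Proof.
pose B := \sum_i dotmul (a i) (a i).
have B0 : 0 <= B by apply: sumr_ge0 => j _; exact: dotmul_ge0.
have hB : forall z, Q z -> dotmul z z <= B.
  apply: convex_hull_bounded => _ [i _ <-]; rewrite /B (bigD1 i)//= lerDl.
  by apply: sumr_ge0 => j _; exact: dotmul_ge0.
(* On the sphere, [l u] in [Q] forces [l ^+ 2 <= B], hence [l <= B + 1]. This uniform bound later
   makes the integrands bounded. *)
exists (B + 1)^-1; first by rewrite invr_gt0; lra.
move=> u u1; rewrite -[gauge _ _]invrK -radial_gauge// lef_pV2 ?posrE; last first.
- by rewrite radial_gauge// invr_gt0 gauge_gt0.
- by lra.
apply: ge_sup.
  exists 0; split => //; apply: ball_sub; rewrite scale0r /unit_ball/=.
  by rewrite enorm_le1 dot0mul.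
move=> l [l0 /hB]; rewrite dotmulZl dotmulZr -sqr_enorm u1 expr1n mulr1 => lB.
by nra.
Qed.

End radial_polytope.

Lemma polytope_radial (R : realType) (d k M : nat) (Q : set 'rV[R]_d) :
    (2 <= d)%N -> (uphalf d - 1 <= k <= d - 1)%N -> polytope Q ->
    unit_ball R d `<=` Q -> (k_faces k Q #<= `I_M)%card ->
  exists vs : seq 'rV[R]_d, exists K : R,
    [/\ (size vs <= M)%N, (forall v, v \in vs -> enorm v <= 1), 0 < K &
      forall u, enorm u = 1 ->
        K <= gauge vs u <= 1 /\ radial Q u = (gauge vs u)^-1].
Proof.
move=> d2 kd [A /finite_seqP[s ->] ->].
have -> : [set` s] = range (tnth (in_tuple s)).
  apply/seteqP; split=> [x /= /(tnthP (in_tuple s))[i ->]|_ [i _ <-]].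
    by exists i.
  by rewrite /= mem_tnth.
move=> bs hM; have [K K0 hK] := gauge_lb bs.
exists (polar_vertices (tnth (in_tuple s))), K; split => //.
- rewrite size_map -cardE; apply: leq_trans (card_polar_faces hM).
  (* Used with [r = k + 1]; the lower bound on [k] is exactly [uphalf d <= r]. *)
  by apply: leq_card_vertices; lia.
- by move=> v /polar_vertex_polar; exact: enorm_polar.
- by move=> u u1; rewrite hK// gauge_le1// radial_gauge.
Qed.

(** * Invariance of the Lebesgue measure *)

Section lebesgue_translation.
Context {R : realType}.
Local Open Scope ereal_scope.

Definition translate (t x : measurableTypeR R) : measurableTypeR R := (x + t)%R.

Lemma measurable_translate t : measurable_fun [set: measurableTypeR R] (translate t).
Proof. exact: measurable_funD. Qed.

HB.instance Definition _ t :=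
  isMeasurableFun.Build _ _ _ _ (translate t) (@measurable_translate t).

Lemma lebesgue_measureD t (A : set R) : measurable A ->
  pushforward lebesgue_measure (translate t) A = lebesgue_measure A.
Proof.
move=> mA; apply/esym/lebesgue_measure_unique => //= _ [[a b]] _ <-.
rewrite /pushforward /=.
have -> : (translate t @^-1` `]a, b])%classic = `](a - t)%R, (b - t)%R]%classic.
  by apply/seteqP; split=> x /=; rewrite /translate !in_itv/= ltrBlDr lerBrDr.
rewrite !lebesgue_measure_itv/= !lte_fin ltrD2r; case: ifPn => // _.
by rewrite -!EFinB; congr EFin; ring.
Qed.

Lemma ge0_integral_translate t (f : measurableTypeR R -> \bar R) :
  measurable_fun [set: measurableTypeR R] f -> (forall x, 0 <= f x) ->
  \int[lebesgue_measure]_x f (x + t)%R = \int[lebesgue_measure]_x f x.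
Proof.
move=> mf f0; transitivity (\int[pushforward lebesgue_measure (translate t)]_x f x).
  by rewrite ge0_integral_pushforward//; exact: measurable_translate.
by apply: eq_measure_integral => A mA _; exact: lebesgue_measureD.
Qed.

Lemma lebesgue_rVS n (A : set 'rV[R]_n.+1) : lebesgue_rV n.+1 A =
  \int[lebesgue_measure]_t lebesgue_rV n [set x | A (rV_cons (t, x))].
Proof.
apply: eq_integral => t _; congr (lebesgue_rV n _).
by apply/seteqP; split => x; rewrite /xsection/= inE.
Qed.

Lemma measurable_slice n (A : set 'rV[R]_n.+1) (t : R) : measurable A ->
  measurable [set x | A (rV_cons (t, x))].
Proof.
move=> mA.
rewrite [X in measurable X](_ : _ = xsection (@rV_cons R n @^-1` A) t).
  apply: measurable_xsection; rewrite -[X in measurable X]setTI.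
  exact: measurable_rV_cons.
by apply/seteqP; split => x; rewrite /xsection/= inE.
Qed.

Lemma measurable_slice_fun n (A : set 'rV[R]_n.+1) : measurable A ->
  measurable_fun [set: measurableTypeR R]
    (fun t => lebesgue_rV n [set x | A (rV_cons (t, x))]).
Proof.
move=> mA.
have mA' : measurable (@rV_cons R n @^-1` A).
  by rewrite -[X in measurable X]setTI; exact: measurable_rV_cons.
have := measurable_fun_xsection (lebesgue_rV n) mA'; congr measurable_fun.
apply/funext => t /=; congr (lebesgue_rV n _).
by apply/seteqP; split => x; rewrite /xsection/= inE.
Qed.

Lemma lebesgue_rVD n (A : set 'rV[R]_n) w : measurable A ->
  lebesgue_rV n [set x | A (x + w)%R] = lebesgue_rV n A.
Proof.
elim: n A w => [|n ih] A w mA.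
  congr (lebesgue_rV 0 _); apply/seteqP; split => x /=; congr A;
    by apply/rowP => -[].
rewrite !lebesgue_rVS -[RHS](ge0_integral_translate (w ord0 ord0)) //; last first.
  exact: measurable_slice_fun.
apply: eq_integral => t _.
rewrite -[RHS](ih _ (\row_i w ord0 (lift ord0 i))%R); last exact: measurable_slice.
have wE x : (rV_cons (t, x) + w = rV_cons ((t + w ord0 ord0)%R,
    (x + \row_i w ord0 (lift ord0 i))%R))%R.
  by apply/rowP => i; rewrite !mxE; case: unliftP => [j ->|->]; rewrite /= ?mxE.
by congr (lebesgue_rV n _); apply/seteqP; split => x /=; rewrite wE.
Qed.

Lemma swap_sections n (E : set ('rV[R]_n * 'rV[R]_n)) : measurable E ->
  \int[lebesgue_rV n]_x lebesgue_rV n [set y | E (x, y)] =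
  \int[lebesgue_rV n]_y lebesgue_rV n [set x | E (x, y)].
Proof.
move=> mE; have := indic_fubini_tonelli (lebesgue_rV n) (lebesgue_rV n) mE.
rewrite indic_fubini_tonelli_FE// indic_fubini_tonelli_GE// => h.
have xE x : xsection E x = [set y | E (x, y)].
  by apply/seteqP; split => y; rewrite /xsection/= inE.
have yE y : ysection E y = [set x | E (x, y)].
  by apply/seteqP; split => x; rewrite /ysection/= inE.
under eq_integral do rewrite -xE.
by under [in RHS]eq_integral do rewrite -yE.
Qed.

End lebesgue_translation.

Lemma mule_cancel (R : realType) (c : R) (x y : \bar R) : 0 < c ->
  (c%:E * x = c%:E * y)%E -> x = y.
Proof.
move=> c0 h; apply/eqP; rewrite eq_le -(@lee_pmul2l _ c%:E)//.
by rewrite -[X in _ && X](@lee_pmul2l _ c%:E)// h lexx.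
Qed.

(** * Linear changes of variables and volumes of balls *)

Section lebesgue_linear.
Context {R : realType} {n : nat}.
Implicit Types (A B : set 'rV[R]_n) (M : 'M[R]_n) (x y : 'rV[R]_n).
Local Notation lam := (lebesgue_rV n).

Lemma measurable_mulmxr m (N : 'M[R]_(m, n)) :
  measurable_fun [set: 'rV[R]_m] (fun z => z *m N).
Proof.
apply/measurable_fun_rVP => i.
rewrite (_ : _ \o _ = fun z => \sum_j coord_rV j z * N j i).
  apply: measurable_sum => j; apply: measurable_funM => //.
  exact: measurable_coord_rV.
by apply/funext => x; rewrite /coord_rV /= mxE.
Qed.

Lemma measurable_rVD d (T : measurableType d) (f g : T -> 'rV[R]_n) :
  measurable_fun setT f -> measurable_fun setT g ->
  measurable_fun setT (fun z => f z + g z).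
Proof.
move=> /measurable_fun_rVP mf /measurable_fun_rVP mg; apply/measurable_fun_rVP => i.
rewrite (_ : _ \o _ = (coord_rV i \o f) \+ (coord_rV i \o g)).
  exact: measurable_funD.
by apply/funext => x; rewrite /coord_rV /= mxE.
Qed.

Lemma measurable_preimage d1 d2 (T1 : measurableType d1) (T2 : measurableType d2)
  (f : T1 -> T2) (B : set T2) : measurable_fun setT f -> measurable B ->
  measurable [set x | B (f x)].
Proof. by move=> mf mB; rewrite -[X in measurable X]setTI; exact: mf. Qed.

Local Notation T2 := ('rV[R]_n * 'rV[R]_n)%type.

Lemma product_sections A B : measurable A -> measurable B ->
  (\int[lam]_x lam [set y | A x /\ B y] = lam A * lam B)%E.
Proof.
move=> mA mB; rewrite -(product_measure1E lam lam mA mB).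
apply: eq_integral => x _; congr (lam _).
by apply/seteqP; split => y; rewrite /xsection /= inE.
Qed.

(* Uniqueness of translation invariant measures, by evaluating the measure of
   [{(x, y) | A x, B (y M + x)}] in both orders. *)
Lemma lebesgue_linear A B M : measurable A -> measurable B -> M \in unitmx ->
  (lam A * lam [set y | B (y *m M)] = lam B * lam [set y | A (- (y *m M))%R])%E.
Proof.
move=> mA mB uM.
have mM := measurable_mulmxr M.
have m1 : measurable_fun [set: T2] fst by exact: measurable_fst.
have m2 : measurable_fun [set: T2] (fun z => z.2 *m M).
  by apply: (measurableT_comp mM); exact: measurable_snd.
have m2N : measurable_fun [set: T2] (fun z => - (z.2 *m M)).
  rewrite (_ : (fun _ => _) = fun z : T2 => z.2 *m (- M)).
    by apply: (measurableT_comp (measurable_mulmxr _)); exact: measurable_snd.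
  by apply/funext => z; rewrite mulmxN.
have mS : measurable [set y | B (y *m M)] by exact: measurable_preimage.
have mSN : measurable [set y | A (- (y *m M))].
  apply: (@measurable_preimage _ _ _ _ (fun y => - (y *m M))) => //.
  rewrite (_ : (fun _ => _) = fun y : 'rV[R]_n => y *m (- M)).
    exact: measurable_mulmxr.
  by apply/funext => z; rewrite mulmxN.
have sec (E : set T2) x : measurable E -> measurable [set y | E (x, y)].
  move=> mE; have := measurable_xsection x mE; congr measurable.
  by apply/seteqP; split => y; rewrite /xsection /= inE.
have sec' (E : set T2) y : measurable E -> measurable [set x | E (x, y)].
  move=> mE; have := measurable_ysection y mE; congr measurable.
  by apply/seteqP; split => x; rewrite /ysection /= inE.
(* [E1], [E2], [E3] and the final set differ by translations of their slices, alternately in [y],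
   [x] and [y]; translation invariance and Tonelli do the rest. *)
pose E1 := [set z : T2 | A z.1 /\ B (z.2 *m M)].
have mE1 : measurable E1.
  by apply: measurableI; exact: measurable_preimage.
pose E2 := [set z : T2 | A z.1 /\ B (z.2 *m M + z.1)].
have mE2 : measurable E2.
  apply: measurableI; first exact: measurable_preimage.
  apply: (@measurable_preimage _ _ _ _ (fun z : T2 => _)) => //.
  exact: measurable_rVD.
pose E3 := [set z : T2 | A (z.1 - z.2 *m M) /\ B z.1].
have mE3 : measurable E3.
  apply: measurableI; last exact: measurable_preimage.
  apply: (@measurable_preimage _ _ _ _ (fun z : T2 => _)) => //.
  exact: measurable_rVD.
rewrite -(product_sections mA mS).
transitivity (\int[lam]_x lam [set y | E2 (x, y)])%E.
  apply: eq_integral => x _.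
  rewrite -(lebesgue_rVD (x *m invmx M) (sec E1 x mE1)); congr (lam _).
  by apply/seteqP; split => y; rewrite /E1/E2/= mulmxDl -mulmxA mulVmx// mulmx1.
rewrite swap_sections//.
transitivity (\int[lam]_y lam [set x | E3 (x, y)])%E.
  apply: eq_integral => y _.
  rewrite -(lebesgue_rVD (y *m M) (sec' E3 y mE3)); congr (lam _).
  by apply/seteqP; split => x; rewrite /E2/E3/= addrK addrC.
rewrite -swap_sections// -(product_sections mB mSN).
apply: eq_integral => x _.
rewrite -(lebesgue_rVD (x *m invmx M) (sec E3 x mE3)); congr (lam _).
apply/seteqP; split => y; rewrite /E3/= mulmxDl -mulmxA mulVmx// mulmx1;
  by rewrite opprD addrCA subrr addr0 => -[].
Qed.

Definition cube (c : R) : set 'rV[R]_n := [set x | forall i, `|x ord0 i| <= c].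

Lemma cubeE (c : R) : cube c = [set x | forall i, `[-c, c]%classic (x ord0 i)].
Proof.
by apply/seteqP; split => x /= h i; have := h i; rewrite /= in_itv/= ler_norml.
Qed.

Lemma lebesgue_cube (c : R) : 0 <= c -> lam (cube c) = ((2 * c) ^+ n)%:E.
Proof.
move=> c0; rewrite cubeE (@lebesgue_rV_box R n (fun=> `[-c, c]%classic))//.
rewrite (eq_bigr (fun=> (2 * c)%:E)).
  by rewrite prodEFin prodr_const card_ord.
move=> i _; rewrite lebesgue_measure_itv/= lte_fin.
case: ltP => cc; first by rewrite -EFinB opprK -mulr2n mulr_natl.
by congr EFin; lra.
Qed.

Lemma measurable_cube (c : R) : measurable (cube c).
Proof.
rewrite cubeE; rewrite [X in measurable X](_ : _ =
    \bigcap_(i in [set: 'I_n]) (coord_rV i @^-1` `[-c, c]%classic)).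
  apply: fin_bigcap_measurable => // i _.
  by rewrite -[X in measurable X]setTI; exact: measurable_coord_rV.
by apply/seteqP; split => x /= Bx i; [move=> _|]; exact: Bx.
Qed.

Lemma kappa_bounds : (0 < lam (unit_ball R n) < +oo)%E.
Proof.
apply/andP; split; last first.
  apply: (@le_lt_trans _ _ (lam (cube 1))).
    apply: le_measure; rewrite ?inE;
      [exact: measurable_unit_ball|exact: measurable_cube|].
    move=> x; rewrite /unit_ball/= enorm_le1 => x1 i.
    rewrite -[1](@normr1 R) -ler_sqr ?nnegrE// !real_normK ?num_real// expr1n.
    apply: le_trans x1; rewrite /dotmul (bigD1 i)//= -expr2 lerDl.
    by apply: sumr_ge0 => j _; rewrite -expr2 sqr_ge0.
  by rewrite lebesgue_cube// ltry.
(* Half the side of a cube inside the ball: [n c^2 <= 1], and [n + 1] avoids dividing by 0. *)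
pose c : R := n.+1%:R^-1.
have c0 : 0 < c by rewrite invr_gt0.
apply: (@lt_le_trans _ _ (lam (cube c))).
  by rewrite lebesgue_cube ?ltW// lte_fin exprn_gt0// mulr_gt0.
apply: le_measure; rewrite ?inE; [exact: measurable_cube|exact: measurable_unit_ball|].
move=> x hx; rewrite /unit_ball/= enorm_le1.
apply: (@le_trans _ _ (\sum_(i < n) c ^+ 2)).
  apply: ler_sum => i _; rewrite -expr2 -(real_normK (num_real (x ord0 i))).
  by rewrite ler_sqr ?nnegrE ?(ltW c0)//; exact: hx.
rewrite sumr_const card_ord -mulr_natr /c exprVn mulrC ler_pdivrMr ?exprn_gt0// mul1r.
rewrite -natrX ler_nat; nia.
Qed.

Lemma kappaE : lam (unit_ball R n) = (kappa R n)%:E.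
Proof.
have /andP[k0 koo] := kappa_bounds; rewrite /kappa fineK// ge0_fin_numE//.
Qed.

Lemma kappa_gt0 : 0 < kappa R n.
Proof. by rewrite -lte_fin -kappaE; have /andP[] := kappa_bounds. Qed.

(** Compare [B] with the unit ball, which [M] preserves, and cancel the volume of the ball. *)
Lemma lebesgue_isometry B M : measurable B -> M \in unitmx ->
  (forall x, enorm (x *m M) = enorm x) -> lam [set y | B (y *m M)] = lam B.
Proof.
move=> mB uM iM; have := lebesgue_linear (@measurable_unit_ball R n) mB uM.
have -> : [set y | unit_ball R n (- (y *m M))] = unit_ball R n.
  apply/seteqP; split => y; rewrite /unit_ball/=;
  by rewrite -scaleN1r enormZ normrN1 mul1r iM.
by rewrite kappaE [RHS]muleC; apply: mule_cancel; exact: kappa_gt0.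
Qed.

(** Comparison with a cube, whose scaled volume is explicit, avoids determinants. *)
Lemma lebesgue_ball (s : R) : 0 < s ->
  lam [set x | enorm x <= s] = (s ^+ n * kappa R n)%:E.
Proof.
move=> s0; have uM : ((s^-1)%:M : 'M[R]_n) \in unitmx.
  by rewrite unitmxE det_scalar unitrX// unitfE invr_eq0 gt_eqF.
have := lebesgue_linear (measurable_cube 1) (@measurable_unit_ball R n) uM.
have -> : [set y | unit_ball R n (y *m (s^-1)%:M)] = [set x | enorm x <= s].
  apply/seteqP; split => y; rewrite /unit_ball/= mul_mx_scalar enormZ;
  by rewrite gtr0_norm ?invr_gt0// mulrC ler_pdivrMr// mul1r.
have -> : [set y | cube 1 (- (y *m (s^-1)%:M))] = cube s.
  apply/seteqP; split => y hy i; have := hy i;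
  rewrite mul_mx_scalar !mxE normrN normrM gtr0_norm ?invr_gt0// mulrC;
  by rewrite ler_pdivrMr// mul1r.
rewrite !lebesgue_cube ?ltW// kappaE.
rewrite -EFinM mulr1 [kappa R n * _]mulrC exprMn -mulrA EFinM; apply: mule_cancel.
exact: exprn_gt0.
Qed.

End lebesgue_linear.

(** * Measure of spherical caps *)

Section cone_volume.
Context {R : realType} {n : nat}.
Implicit Types (x v : 'rV[R]_n.+1) (t tau c : R).

Lemma dotmul_cons t (x : 'rV[R]_n) :
  dotmul (rV_cons (t, x)) (rV_cons (t, x)) = t ^+ 2 + dotmul x x.
Proof.
rewrite /dotmul big_ord_recl !mxE unlift_none /= -expr2; congr +%R.
by apply: eq_bigr => i _; rewrite !mxE liftK.
Qed.

Lemma sqr_coord_le x i : x ord0 i ^+ 2 <= dotmul x x.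
Proof.
rewrite /dotmul (bigD1 i)//= -expr2 lerDl.
by apply: sumr_ge0 => j _; rewrite -expr2 sqr_ge0.
Qed.

(** Each slice of the ball lies in the unit ball one dimension below and is empty outside [[-1, 1]].
    This is what later keeps [delta] below 2. *)
Lemma kappaS_le : kappa R n.+1 <= 2 * kappa R n.
Proof.
rewrite -lee_fin -kappaE lebesgue_rVS.
pose J : set R := `[-1, 1]%classic; have mJ : measurable J by exact: measurable_itv.
have mB := @measurable_unit_ball R n.+1.
have -> : (2 * kappa R n)%:E =
    (\int[lebesgue_measure]_t ((cst (kappa R n)%:E) \_ J) t)%E.
  rewrite -integral_mkcond integral_cst//= /J lebesgue_measure_itv/= lte_fin.
  by rewrite ifT; [rewrite -EFinB -EFinM; congr EFin; ring|lra].
apply: ge0_le_integral => //.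
- exact: measurable_slice_fun.
- by apply/measurable_restrict => //; exact: measurable_cst.
move=> t _; rewrite patchE; case: ifPn => [_|].
  rewrite /cst -kappaE; apply: le_measure; rewrite ?inE;
    [exact: measurable_slice|exact: measurable_unit_ball|].
  move=> x; rewrite /unit_ball/= !enorm_le1 dotmul_cons; apply: le_trans.
  by rewrite lerDr sqr_ge0.
rewrite notin_setE /J /= in_itv/= => /negP tI.
rewrite (_ : [set _ | _] = set0) ?measure0// -subset0 => x.
rewrite /unit_ball/= enorm_le1 dotmul_cons => h; apply: (negP tI).
have := dotmul_ge0 x => x0.
by rewrite -ler_norml -(expr_le1 (n := 2))// real_normK ?num_real//; lra.
Qed.

(** The cone of height 1 along the first axis over a disc of radius [tau], apex removed. *)
Definition round_cone tau : set 'rV[R]_n.+1 :=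
  [set x : 'rV[R]_n.+1 | 0 < x ord0 ord0 <= 1 /\
    dotmul x x <= (1 + tau ^+ 2) * x ord0 ord0 ^+ 2].

Lemma measurable_round_cone tau : measurable (round_cone tau).
Proof.
apply: measurableI.
  apply: (@measurable_preimage _ _ _ _ (coord_rV ord0) [set t | 0 < t <= 1]).
    exact: measurable_coord_rV.
  suff -> : [set t : R | 0 < t <= 1] = `]0, 1]%classic by exact: measurable_itv.
  by apply/seteqP; split => t /=; rewrite in_itv.
rewrite -[X in measurable X]setTI; apply: measurable_fun_le => //.
  exact: measurable_dotmul.
apply: measurable_funM => //; apply: measurable_funX; exact: measurable_coord_rV.
Qed.

(** The slice at height [t] lies in a ball of radius [tau * t]; the integral of [t ^+ n] over
    [[0, 1]] is read off as a beta function. *)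
Lemma lebesgue_round_cone tau : 0 < tau ->
  (lebesgue_rV n.+1 (round_cone tau) <= (kappa R n * tau ^+ n / n.+1%:R)%:E)%E.
Proof.
move=> tau0; rewrite lebesgue_rVS.
have -> : (kappa R n * tau ^+ n / n.+1%:R)%:E =
    ((kappa R n * tau ^+ n)%:E *
     \int[lebesgue_measure]_t ((XMonemX n 0 \_ `[(0:R), 1]) t)%:E)%E.
  rewrite -(@EFin_beta_fun R n.+1 1) -EFinM; congr (_ * _)%:E.
  by rewrite beta_fun_sym beta_fun1Sn.
have mX : measurable_fun setT (XMonemX n 0 \_ `[(0:R), 1]).
  by apply/measurable_restrict => //; exact: measurable_XMonemX.
have X0 t : 0 <= (XMonemX n 0 \_ `[(0:R), 1]) t.
  by rewrite patchE; case: ifPn => //; rewrite inE/= => /XMonemX_ge0.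
have kt0 : 0 <= kappa R n * tau ^+ n.
  by rewrite mulr_ge0 ?exprn_ge0 ?kappa_ge0// ltW.
rewrite -ge0_integralZl//; last 2 first.
- exact/measurable_EFinP.
- by move=> t _; rewrite lee_fin.
have mC := measurable_round_cone tau.
apply: ge0_le_integral => //.
- exact: measurable_slice_fun.
- apply: measurable_funeM; exact/measurable_EFinP.
move=> t _; have [/andP[t0 t1]|tI] := boolP (0 < t <= 1).
  rewrite patchE ifT; last by rewrite inE/= in_itv/= t1 ltW.
  rewrite XMonemXn0 -EFinM.
  have -> : kappa R n * tau ^+ n * t ^+ n = (tau * t) ^+ n * kappa R n.
    by rewrite exprMn; ring.
  rewrite -lebesgue_ball ?mulr_gt0//.
  apply: le_measure; rewrite ?inE.
  + exact: measurable_slice.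
  + rewrite -[X in measurable X]setTI; apply: measurable_fun_le => //.
    exact: measurable_enorm.
  move=> x; rewrite /round_cone/= dotmul_cons !mxE unlift_none /= => -[_ h].
  rewrite -ler_sqr ?nnegrE ?enorm_ge0// ?mulr_ge0 ?(ltW tau0) ?(ltW t0)//.
  rewrite sqr_enorm exprMn.
  by move: h; rewrite mulrDl mul1r lerD2l.
rewrite (_ : [set _ | _] = set0); first by rewrite measure0 mule_ge0// lee_fin.
rewrite -subset0 => x [+ _]; rewrite !mxE unlift_none/=.
by apply/negP.
Qed.

(* The Householder reflection exchanging [v] and the first basis vector. *)
Lemma rotate_to_axis v : enorm v = 1 -> exists2 M : 'M[R]_n.+1, M \in unitmx &
  forall x, enorm (x *m M) = enorm x /\ (x *m M) ord0 ord0 = dotmul x v.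
Proof.
move=> v1; have vv : dotmul v v = 1 by rewrite -sqr_enorm v1 expr1n.
pose e : 'rV[R]_n.+1 := delta_mx ord0 ord0.
have [w wE] : exists w, w = v - e by exists (v - e).
have dote x : dotmul x e = x ord0 ord0.
  rewrite /dotmul (bigD1 ord0)//= big1 ?addr0 => [|i i0]; rewrite mxE eqxx.
    by rewrite mulr1.
  by rewrite (negbTE i0) mulr0.
(* If [v] is already [e], then [w = 0], so [c = 0] by the convention on division and [M] is the
   identity. *)
pose c := 2 / dotmul w w.
pose M := 1%:M - c *: (w^T *m w).
have ME x : x *m M = x - (c * dotmul x w) *: w.
  rewrite mulmxBr mulmx1 -scalemxAr mulmxA; congr (_ - _).
  rewrite (_ : x *m w^T = (dotmul x w)%:M) ?mul_scalar_mx ?scalerA//.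
  by apply/matrixP => i j; rewrite !ord1 dotmulE !mxE eqxx mulr1n.
have cw : c * (c * dotmul w w) = 2 * c.
  have [w0|w0] := eqVneq (dotmul w w) 0; first by rewrite /c w0 invr0 !mulr0.
  by rewrite /c; field.
have MM : M *m M = 1%:M.
  apply/row_matrixP => i; rewrite !rowE mulmxA mulmx1 !ME.
  rewrite dotmulBl dotmulZl -addrA -opprD -scalerDl.
  set z := dotmul _ w.
  have -> : c * z + c * (z - c * z * dotmul w w) =
    z * (2 * c - c * (c * dotmul w w)) by ring.
  by rewrite cw subrr mulr0 scale0r subr0.
exists M; first by case: (mulmx1_unit MM).
move=> x; split.
  rewrite /enorm ME; congr Num.sqrt.
  rewrite !(dotmulBl, dotmulBr, dotmulZl, dotmulZr) (dotmulC w x).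
  set z := dotmul x w.
  transitivity (dotmul x x - z ^+ 2 * (2 * c - c * (c * dotmul w w))); first by ring.
  by rewrite cw subrr mulr0 subr0.
have w00 : w ord0 ord0 = v ord0 ord0 - 1 by rewrite wE !mxE.
rewrite ME !mxE w00.
have ww : dotmul w w = - 2 * (v ord0 ord0 - 1).
  have ee : dotmul e e = 1 by rewrite dote mxE.
  rewrite wE !(dotmulBl, dotmulBr) vv ee (dotmulC e v) dote; ring.
have xw : dotmul x w = dotmul x v - x ord0 ord0 by rewrite wE dotmulBr dote.
have [w0|w0] := eqVneq (dotmul w w) 0.
  move: xw; rewrite /c w0 invr0 mulr0 !mul0r subr0.
  by move/eqP: w0; rewrite dotmul_eq0 => /eqP ->; rewrite dotmul0; lra.
rewrite xw /c ww; field.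
by move: w0; rewrite ww; apply: contra => /eqP h; apply/eqP; lra.
Qed.

End cone_volume.

(** * Normalized measure of the sphere and of its caps *)

Section sphere_caps.
Context {R : realType} {n : nat}.
Implicit Types (x u v : 'rV[R]_n.+1) (c tau : R).
Local Notation sigma := (sphere_measure R n.+1).
Local Notation sphere := (unit_sphere R n.+1).

Lemma measurable_superlevel d (T : measurableType d) (f : T -> R) c :
  measurable_fun setT f -> measurable [set u | c < f u].
Proof.
move=> mf; apply: (measurable_preimage mf (B := [set t : R | c < t])).
suff -> : [set t : R | c < t] = `]c, +oo[%classic by exact: measurable_itv.
by apply/seteqP; split => t /=; rewrite in_itv/= andbT.
Qed.

Lemma measurable_unit_sphere : measurable sphere.
Proof.
rewrite (_ : sphere = @enorm R n.+1 @^-1` [set 1]); last by [].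
by rewrite -[X in measurable X]setTI; exact: measurable_enorm.
Qed.

Lemma measurable_dotmulr v :
  measurable_fun [set: 'rV[R]_n.+1] (fun u => dotmul v u).
Proof.
by apply: measurable_sum => i; apply: measurable_funM => //; exact: measurable_coord_rV.
Qed.

Lemma measurable_gauge (vs : seq 'rV[R]_n.+1) :
  measurable_fun [set: 'rV[R]_n.+1] (gauge vs).
Proof.
rewrite /gauge; elim: vs => [|v vs ih].
  rewrite (_ : (fun _ => _) = cst 0); first exact: measurable_cst.
  by apply/funext => u; rewrite big_nil.
rewrite (_ : (fun _ => _) = fun u =>
    Num.max (dotmul v u) (\big[Num.max/0]_(v <- vs) dotmul v u)).
  exact: (measurable_maxr (measurable_dotmulr v) ih).
by apply/funext => u; rewrite big_cons.
Qed.

Lemma sphere_measureE (A : set 'rV[R]_n.+1) : sigma A =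
  ((kappa R n.+1)^-1%:E *
   lebesgue_rV n.+1 (unit_ball R n.+1 `&` @direction R n.+1 @^-1` A))%E.
Proof. by []. Qed.

(** Every nonzero point of the ball has its direction on the sphere, and the origin is null, being a
    cube of side 0. *)
Lemma sphere_measure_sphere : sigma sphere = 1%E.
Proof.
have k0 := @kappa_gt0 R n.+1.
rewrite sphere_measureE.
suff -> : lebesgue_rV n.+1 (unit_ball R n.+1 `&`
    @direction R n.+1 @^-1` sphere) = (kappa R n.+1)%:E.
  by rewrite -EFinM mulVf// gt_eqF.
have ms0 : measurable [set 0 : 'rV[R]_n.+1].
  rewrite (_ : [set 0] = cube 0); first exact: measurable_cube.
  apply/seteqP; split => x /= => [-> i|h]; first by rewrite mxE normr0.
  by apply/rowP => i; rewrite mxE; apply/eqP; rewrite -normr_le0; exact: h.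
rewrite -kappaE -[in RHS](setDUK (_ : [set 0] `<=` unit_ball R n.+1)); last first.
  by move=> _ ->; rewrite /unit_ball/= enorm_le1 dot0mul.
have mD : measurable (unit_ball R n.+1 `\` [set 0]).
  by apply: measurableD => //; exact: measurable_unit_ball.
rewrite measureU//; last by rewrite setDE setICA setICr setI0.
have z0 : lebesgue_rV n.+1 [set 0 : 'rV[R]_n.+1] = 0%E.
  apply/eqP; rewrite eq_le measure_ge0 andbT.
  rewrite -[X in (_ <= X)%E](_ : lebesgue_rV n.+1 (cube 0) = 0%E); last first.
    by rewrite lebesgue_cube// mulr0 expr0n.
  apply: le_measure; rewrite ?inE//; first exact: measurable_cube.
  by move=> _ -> i; rewrite mxE normr0.
rewrite [X in (X + _)%E]z0 add0e; congr (lebesgue_rV _ _).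
apply/seteqP; split => x [Bx h]; split => //.
  move=> x0; move: h; rewrite /unit_sphere/= x0 /direction scaler0.
  by rewrite enorm0 => /eqP; rewrite eq_sym oner_eq0.
by rewrite /unit_sphere/= /direction enorm_normalize//; apply/eqP.
Qed.

Lemma measurable_cap v c : measurable (sphere `&` [set u | c < dotmul v u]).
Proof.
apply: measurableI; first exact: measurable_unit_sphere.
apply: measurable_superlevel; exact: measurable_dotmulr.
Qed.

(* The cone over a cap of angular radius [arctan tau] lies in the cone over the
   disc of radius [tau] in the tangent hyperplane. *)
Lemma cap_measure v c tau : enorm v <= 1 -> 0 <= c -> 0 < tau ->
    (1 + tau ^+ 2) * c ^+ 2 = 1 ->
  (sigma (sphere `&` [set u | (c < dotmul v u)%R]) <=
   (kappa R n * tau ^+ n / omega R n.+1)%:E)%E.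
Proof.
move=> v1 c0 tau0 ctau; have k0 := @kappa_gt0 R n.+1.
have [->|vn0] := eqVneq v 0.
  rewrite (_ : _ `&` _ = set0); last first.
    by rewrite -subset0 => u [_] /=; rewrite dot0mul ltNge c0.
  rewrite measure0 lee_fin /omega divr_ge0 ?mulr_ge0 ?exprn_ge0 ?kappa_ge0//.
  exact: ltW.
have v0 : 0 < enorm v by rewrite enorm_gt0.
have [M uM rot] := rotate_to_axis (enorm_normalize vn0).
have mC := @measurable_round_cone R n tau.
have -> : kappa R n * tau ^+ n / omega R n.+1 =
    (kappa R n.+1)^-1 * (kappa R n * tau ^+ n / n.+1%:R).
  by rewrite /omega invfM; ring.
rewrite sphere_measureE EFinM lee_pmul2l ?lte_fin ?invr_gt0//.
apply: le_trans (lebesgue_round_cone tau0).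
rewrite -(lebesgue_isometry mC uM); last by move=> x; have [] := rot x.
apply: le_measure; rewrite ?inE.
- apply: measurableI; first exact: measurable_unit_ball.
  rewrite -[X in measurable X]setTI; apply: measurable_direction => //.
  exact: measurable_cap.
- apply: (measurable_preimage _ mC); exact: measurable_mulmxr.
move=> x [Bx [/= dx1]]; rewrite /direction dotmulZr => cx.
have xn0 : x != 0.
  apply/eqP => x0; move: dx1.
  rewrite /unit_sphere/= /direction x0 scaler0 enorm0 => /eqP.
  by rewrite eq_sym oner_eq0.
have x0 : 0 < enorm x by rewrite enorm_gt0.
have [xM xM0] := rot x; rewrite /round_cone/=.
set t := (x *m M) ord0 ord0 in xM0 *.
(* Normalizing [v] does not decrease the product with [x]: it is positive and [enorm v <= 1]. *)
have tx : c * enorm x < t.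
  rewrite xM0 dotmulZr.
  have : c * enorm x < dotmul v x by rewrite mulrC -ltr_pdivlMl.
  move=> /lt_le_trans; apply; rewrite dotmulC ler_peMl ?invf_ge1//.
  rewrite dotmulC; have : 0 < (enorm x)^-1 * dotmul v x by apply: le_lt_trans cx.
  by rewrite pmulr_rgt0 ?invr_gt0// => /ltW.
have t0 : 0 < t by apply: le_lt_trans tx; rewrite mulr_ge0// ltW.
have xx : dotmul (x *m M) (x *m M) = enorm x ^+ 2 by rewrite -sqr_enorm xM.
split.
  rewrite t0 -(expr_le1 (n := 2))// ?(ltW t0)//.
  apply: (le_trans (sqr_coord_le (x *m M) ord0)).
  by rewrite xx expr_le1// enorm_ge0.
rewrite xx; apply: (@le_trans _ _ ((1 + tau ^+ 2) * (c * enorm x) ^+ 2)).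
  by rewrite exprMn mulrA ctau mul1r.
rewrite ler_pM2l; last by rewrite ltr_pwDl// sqr_ge0.
by rewrite ler_sqr ?nnegrE ?mulr_ge0 ?enorm_ge0// ltW.
Qed.

Lemma caps_measure (vs : seq 'rV[R]_n.+1) c tau :
    (forall v, v \in vs -> enorm v <= 1) -> 0 <= c -> 0 < tau ->
    (1 + tau ^+ 2) * c ^+ 2 = 1 ->
  (sigma (sphere `&` [set u | (c < gauge vs u)%R]) <=
   ((size vs)%:R * (kappa R n * tau ^+ n / omega R n.+1))%:E)%E.
Proof.
move=> + c0 tau0 ctau; elim: vs => [_|v vs ih hv].
  rewrite (_ : _ `&` _ = set0) ?measure0 ?mul0r// -subset0 => u [_] /=.
  by rewrite /gauge big_nil ltNge c0.
have mG : measurable (sphere `&` [set u | c < gauge vs u]).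
  apply: measurableI; first exact: measurable_unit_sphere.
  apply: measurable_superlevel; exact: measurable_gauge.
have -> : sphere `&` [set u | c < gauge (v :: vs) u] =
    (sphere `&` [set u | c < dotmul v u]) `|` (sphere `&` [set u | c < gauge vs u]).
  rewrite -setIUr; congr (_ `&` _); apply/seteqP; split => u /=;
  rewrite /gauge big_cons lt_max; last by move=> /orP.
  by move=> /orP.
apply: le_trans (measureU2 _ (measurable_cap v c) mG) _.
have hvs w : w \in vs -> enorm w <= 1.
  by move=> wvs; apply: hv; rewrite in_cons wvs orbT.
apply: le_trans (leeD (cap_measure (hv v (mem_head v vs)) c0 tau0 ctau) (ih hvs)) _.
by rewrite -EFinD lee_fin /= -natr1 mulrDl mul1r addrC.
Qed.

End sphere_caps.

(** * Deviation bounds *)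

Section real_bounds.
Context {R : realType}.
Implicit Types (x m q L dl : R).

(** From [expR (x / 3) * (1 - x / 3) <= 1] and [(1 + x) (1 - x / 3) >= 1], the latter valid up to
    [x = 2]. *)
Lemma ln1D_ge x : 0 <= x <= 2 -> x / 3 <= ln (1 + x).
Proof.
move=> /andP[x0 x2]; rewrite -[x / 3]expRK ler_ln ?posrE ?expR_gt0//; last by lra.
have h := expR_ge1Dx (- (x / 3)); have e0 := expR_gt0 (x / 3).
have : expR (x / 3) * (1 + - (x / 3)) <= 1.
  by rewrite -[X in _ <= X](@expR0 R) -(subrr (x / 3)) expRD ler_pM2l.
nra.
Qed.

(* Chord bound for the convex function [m |-> expR (- m)] on [0, 1], from its
   tangent at [m]. *)
Lemma onem_expRN_ge m : 0 <= m <= 1 -> (1 - expR (- 1)) * m <= 1 - expR (- m).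
Proof.
move=> /andP[m0 m1]; have e0 := expR_gt0 (- m).
have h1 : expR (- m) * (1 + m) <= 1.
  rewrite -[X in _ <= X](@expR0 R) -[0 in X in _ <= X](addNr m) expRD ler_pM2l//.
  exact: expR_ge1Dx.
have h2 : expR (- m) * m <= expR (- 1).
  rewrite -[- 1 in X in _ <= X](addKr m) expRD ler_pM2l//.
  by have := expR_ge1Dx (m + -1); rewrite addrCA subrr addr0.
have h3 : (1 - m) * (expR (- m) * (1 + m)) <= (1 - m) * 1.
  by rewrite ler_wpM2l// subr_ge0.
have h4 : m * (expR (- m) * m) <= m * expR (- 1) by rewrite ler_wpM2l.
nra.
Qed.

(** The truncation at 1 puts [m] in the range of the chord bound. For [q >= 0], [expR (q L) - 1 >= q
    L >= m >= 1 - expR (- m)]; for [q < 0], [expR (q L) <= expR (- m)]. *)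
Lemma norm_onem_expR_ge q L dl : 0 <= dl -> dl / 6 <= L ->
  (1 - expR (- 1)) * Num.min 1 (`|q| / 6 * dl) <= `|1 - expR (q * L)|.
Proof.
move=> dl0 dlL; set m := Num.min _ _.
have qdl0 : 0 <= `|q| / 6 * dl by rewrite mulr_ge0// divr_ge0.
have m01 : 0 <= m <= 1 by rewrite /m le_min ler01 qdl0 ge_min lexx.
have mq : m <= `|q| * L.
  apply: (@le_trans _ _ (`|q| / 6 * dl)); first by rewrite /m ge_min lexx orbT.
  by rewrite -mulrA ler_wpM2l//; lra.
have /andP[m0 m1] := m01.
apply: le_trans (onem_expRN_ge m01) _.
have [q0|q0] := ltP q 0; last first.
  rewrite ger0_norm// in mq.
  rewrite distrC; apply: le_trans (ler_norm _).
  have := expR_ge1Dx (q * L); have := expR_ge1Dx (- m); lra.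
rewrite ltr0_norm// in mq.
apply: le_trans (ler_norm _); rewrite lerD2l lerN2 ler_expR; lra.
Qed.

Lemma sqr_succ_le n : ((n.+1 ^ 2 <= 4 * 2 ^ n)%N).
Proof.
elim: n => [//|[|[|n]] ih] //; rewrite [(2 ^ n.+3)%N]expnS -!mulnn in ih *.
by move: ih; move: (2 ^ n.+2)%N => p; nia.
Qed.

(** [tau] is the n-th root of [A / M], and it becomes the tangent of the angular radius of the caps.
    The last bound holds since [delta ^+ n = (A / M) ^+ 2] is at most [((n + 1) / 2) ^+ 2], hence at
    most [2 ^+ n]. *)
Lemma delta_bounds n M (A : R) : (0 < n)%N -> (0 < M)%N ->
    0 < A <= n.+1%:R / 2 ->
    let delta := A `^ (2 / n%:R) * M%:R `^ (- (2 / n%:R)) in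
  exists tau, [/\ 0 < tau, tau ^+ 2 = delta, tau ^+ n = A / M%:R & delta <= 2].
Proof.
move=> n0 M0 /andP[A0 An] delta.
have n0' : (n%:R : R) != 0 by rewrite pnatr_eq0 -lt0n.
have M0' : (0 : R) < M%:R by rewrite ltr0n.
have AM : 0 < A / M%:R by rewrite divr_gt0.
pose tau := (A / M%:R) `^ (n%:R^-1).
have tau0 : 0 < tau by exact: powR_gt0.
have tau2 : tau ^+ 2 = delta.
  rewrite -powR_mulrn ?ltW// -powRrM (mulrC n%:R^-1).
  rewrite powRM ?invr_ge0 ?(ltW A0) ?(ltW M0')//.
  by rewrite /delta -[M%:R^-1]powR_inv1 ?(ltW M0')// -powRrM mulN1r.
have taun : tau ^+ n = A / M%:R.
  by rewrite -powR_mulrn ?ltW// -powRrM mulVf// powRr1// ltW.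
exists tau; split => //.
have d0 : 0 <= delta by rewrite -tau2 exprn_ge0// ltW.
rewrite -(@ler_pXn2r _ n) ?nnegrE// -tau2 exprAC taun.
apply: (@le_trans _ _ ((n.+1%:R / 2) ^+ 2)).
  rewrite ler_sqr ?nnegrE ?(ltW AM) ?divr_ge0//; apply: le_trans An.
  by rewrite ler_pdivrMr// ler_peMr ?(ltW A0)// ler1n.
have := sqr_succ_le n; rewrite -(ler_nat R) natrM !natrX expr_div_n; lra.
Qed.

End real_bounds.

(** * Integrals over the sphere *)

Section sphere_integrals.
Context {R : realType} {n : nat}.
Local Notation sigma := (sphere_measure R n.+1).
Local Notation sphere := (unit_sphere R n.+1).

Lemma Rintegral_sphere_ge (f : 'rV[R]_n.+1 -> R) (vs : seq 'rV[R]_n.+1) (c m C : R) :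
    measurable_fun [set: 'rV[R]_n.+1] f ->
    (forall u, sphere u -> 0 <= f u <= C) ->
    (sigma (sphere `&` [set u | (c < gauge vs u)%R]) <= (1 / 4)%:E)%E ->
    0 <= m -> (forall u, sphere u -> gauge vs u <= c -> m <= f u) ->
  3 / 4 * m <= \int[sigma]_(u in sphere) f u.
Proof.
move=> mf f01 hc m0 hm.
have mS := @measurable_unit_sphere R n.
have mfE D : measurable_fun D (EFin \o f).
  exact/measurable_EFinP/measurable_funTS.
have m1 : measurable (sphere `&` [set u | c < gauge vs u]).
  apply: measurableI => //.
  apply: measurable_superlevel; exact: measurable_gauge.
pose E := sphere `\` (sphere `&` [set u | c < gauge vs u]).
have mE : measurable E by exact: measurableD.
have ES : E `<=` sphere by move=> u [].
have EP u : E u -> sphere u /\ gauge vs u <= c.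
  by move=> [Su nu]; split=> //; rewrite leNgt; apply/negP => h; exact: nu.
have sE : ((3 / 4)%:E <= sigma E)%E.
  have : sigma sphere = (sigma E + sigma (sphere `&` [set u | (c < gauge vs u)%R]))%E.
    rewrite -measureU//; last by rewrite /E setDKI.
    by rewrite setUC setDUK//; exact: subIsetl.
  rewrite sphere_measure_sphere => s1.
  have sfin : sigma (sphere `&` [set u | (c < gauge vs u)%R]) \is a fin_num.
    by rewrite ge0_fin_numE// (le_lt_trans hc)// ltry.
  have -> : sigma E = (1 - sigma (sphere `&` [set u | (c < gauge vs u)%R]))%E.
    by rewrite s1 addeK.
  rewrite leeBrDr//; apply: le_trans (leeD2l _ hc) _.
  by rewrite -EFinD lee_fin; lra.
(* The bound [C] makes the integral finite; otherwise its real value would be the default 0. *)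
have up : (\int[sigma]_(u in sphere) (f u)%:E <= C%:E)%E.
  apply: (@le_trans _ _ (\int[sigma]_(u in sphere) (cst C%:E) u)%E).
    apply: ge0_le_integral => //.
    - by move=> u Su; rewrite lee_fin; have /andP[] := f01 u Su.
    - by move=> u Su; rewrite lee_fin; have /andP[] := f01 u Su.
  by rewrite integral_cst//= sphere_measure_sphere mule1.
have low : ((3 / 4 * m)%:E <= \int[sigma]_(u in sphere) (f u)%:E)%E.
  apply: (@le_trans _ _ (\int[sigma]_(u in E) (cst m%:E) u)%E).
    by rewrite integral_cst// mulrC EFinM lee_wpmul2l.
  apply: (@le_trans _ _ (\int[sigma]_(u in E) (f u)%:E)%E).
    apply: ge0_le_integral => //.
    by move=> u /EP[Su gu]; rewrite lee_fin; exact: hm.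
  apply: ge0_subset_integral => //.
  by move=> u Su; rewrite lee_fin; have /andP[] := f01 u Su.
rewrite /Rintegral -lee_fin fineK//.
rewrite ge0_fin_numE; first by apply: le_lt_trans up _; rewrite ltry.
by apply: integral_ge0 => u Su; rewrite lee_fin; have /andP[] := f01 u Su.
Qed.

Lemma radial_unit_ball u : enorm u = 1 -> radial (unit_ball R n.+1) u = 1.
Proof.
move=> u1; have E1 : [set l : R | 0 <= l /\ unit_ball R n.+1 (l *: u)] 1.
  by split => //; rewrite scale1r /unit_ball/= u1.
have ub : ubound [set l : R | 0 <= l /\ unit_ball R n.+1 (l *: u)] 1.
  by move=> l [l0]; rewrite /unit_ball/= enormZ u1 mulr1 ger0_norm.
apply/eqP; rewrite eq_le ge_sup//; last by exists 1.
by apply: ub_le_sup => //; exists 1.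
Qed.

Lemma dual_volume_ball_ge0 d q : 0 <= @dual_volume_ball R d q.
Proof.
have G0 (x : R) : 0 <= Gamma x.
  by apply: Rintegral_ge0 => t _; rewrite mulr_ge0 ?powR_ge0 ?expR_ge0.
apply: mulr_ge0; last exact: divr_ge0.
by apply: mulr_ge0; [exact: powR_ge0|apply: divr_ge0 => //; exact: mulr_ge0].
Qed.

End sphere_integrals.

Section deviation_bounds.
Context {R : realType} {n : nat}.
Variables (vs : seq 'rV[R]_n.+1) (K : R) (Q : set 'rV[R]_n.+1).
Hypothesis K0 : 0 < K.
Hypothesis gauge_bounds : forall u, enorm u = 1 ->
  K <= gauge vs u <= 1 /\ radial Q u = (gauge vs u)^-1.
Variables (c dl : R).
Hypothesis c_ge0 : 0 <= c.
Hypothesis dl_bounds : 0 <= dl <= 2.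
Hypothesis cdl : (1 + dl) * c ^+ 2 = 1.
Hypothesis small_caps : (sphere_measure R n.+1
  (unit_sphere R n.+1 `&` [set u | (c < gauge vs u)%R]) <= (1 / 4)%:E)%E.

Lemma ln_radial u : enorm u = 1 -> 0 <= - ln (gauge vs u) <= - ln K.
Proof.
move=> u1; have [/andP[Kg g1] _] := gauge_bounds u1.
have g0 : 0 < gauge vs u by apply: lt_le_trans Kg.
by rewrite oppr_ge0 ln_le0//= lerN2 ler_ln.
Qed.

(** Here [c] is the inverse square root of [1 + dl], so twice the logarithm of the radial function
    is at least [ln (1 + dl)], hence at least [dl / 3]. *)
Lemma ln_radial_ge u : enorm u = 1 -> gauge vs u <= c -> dl / 6 <= - ln (gauge vs u).
Proof.
move=> u1 gc; have [/andP[Kg g1] _] := gauge_bounds u1.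
have g0 : 0 < gauge vs u by apply: lt_le_trans Kg.
have /andP[dl0 dl2] := dl_bounds.
have : ln ((1 + dl) * gauge vs u ^+ 2) <= 0.
  apply/ln_le0/(@le_trans _ _ ((1 + dl) * c ^+ 2)); last by rewrite cdl.
  by rewrite ler_pM2l ?ler_sqr ?nnegrE ?(ltW g0)//; lra.
rewrite lnM ?posrE ?exprn_gt0//; last by lra.
rewrite lnXn// mulr2n; have := ln1D_ge dl_bounds; lra.
Qed.

Lemma measurable_ln_gauge :
  measurable_fun [set: 'rV[R]_n.+1] (fun u => - ln (gauge vs u)).
Proof.
apply: measurableT_comp => //; apply: measurableT_comp; last exact: measurable_gauge.
exact: measurable_ln.
Qed.

Lemma dual_deviation_ge q : 0 <= c1 n.+1 q ->
  c1 n.+1 q * (3 / 4 * ((1 - expR (- 1)) * Num.min 1 (`|q| / 6 * dl))) <=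
  dual_deviation q (unit_ball R n.+1) Q.
Proof.
move=> c10; rewrite /dual_deviation ler_wpM2l//.
(* The radial function of the ball is 1, and the q-th power of that of [Q] is an exponential, which
   treats both signs of [q] together. *)
rewrite [leRHS](_ : _ = \int[sphere_measure R n.+1]_(u in unit_sphere R n.+1)
    `|1 - expR (q * - ln (gauge vs u))|); last first.
  apply: eq_Rintegral => u; rewrite inE => u1.
  have [/andP[Kg g1] ->] := gauge_bounds u1.
  have g0 : 0 < gauge vs u by apply: lt_le_trans Kg.
  by rewrite radial_unit_ball// powR1 /powR gt_eqF ?invr_gt0// lnV.
have /andP[dl0 dl2] := dl_bounds.
have e1 : 0 <= 1 - expR (- 1) :> R.
  by rewrite subr_ge0 -[leRHS]expR0 ler_expR; lra.
apply: (@Rintegral_sphere_ge _ _ _ vs c _ (1 + expR (`|q| * - ln K))) => //.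
- apply: measurableT_comp => //; apply: measurable_funB; first exact: measurable_cst.
  apply: measurableT_comp => //; apply: measurable_funM; first exact: measurable_cst.
  exact: measurable_ln_gauge.
- move=> u u1; rewrite normr_ge0/=; have /andP[l0 l1] := ln_radial u1.
  apply: le_trans (ler_normB _ _) _; rewrite normr1 lerD2l ger0_norm ?expR_ge0//.
  rewrite ler_expR; apply: (@le_trans _ _ (`|q| * - ln (gauge vs u))).
    by rewrite ler_wpM2r// ler_norm.
  by rewrite ler_wpM2l.
- by rewrite mulr_ge0// le_min ler01 mulr_ge0// divr_ge0.
- move=> u u1 gc; apply: norm_onem_expR_ge => //; exact: ln_radial_ge.
Qed.

Lemma log_deviation_ge : unit_ball R n.+1 `<=` Q ->
  3 / 4 * (dl / 6) <= log_deviation (unit_ball R n.+1) Q.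
Proof.
move=> BQ; have ball0 : log_volume (unit_ball R n.+1) = 0.
  transitivity (\int[sphere_measure R n.+1]_(u in unit_sphere R n.+1) (0 : R)).
    apply: eq_Rintegral => u; rewrite inE => u1.
    by rewrite radial_unit_ball// ln1.
  by rewrite /Rintegral integral0.
rewrite /log_deviation setIidl// ball0 mulr0 add0r subr0 /log_volume.
rewrite [leRHS](_ : _ = \int[sphere_measure R n.+1]_(u in unit_sphere R n.+1)
    (- ln (gauge vs u))); last first.
  apply: eq_Rintegral => u; rewrite inE => u1.
  have [/andP[Kg g1] ->] := gauge_bounds u1.
  by rewrite lnV// posrE; apply: lt_le_trans Kg.
have /andP[dl0 dl2] := dl_bounds.
apply: (@Rintegral_sphere_ge _ _ _ vs c _ (- ln K)) => //.
- exact: measurable_ln_gauge.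
- by move=> u; exact: ln_radial.
- by rewrite divr_ge0.
- by move=> u; exact: ln_radial_ge.
Qed.

End deviation_bounds.

Theorem theorem3p8 (R : realType) (d k M : nat) (q : R)
    (Q : set 'rV[R]_d)
    (hd : (2 <= d)%N)
    (hk : (uphalf d - 1 <= k <= d - 1)%N)
    (hM : (0 < M)%N)
    (hQ : polytope Q)
    (hBQ : unit_ball R d `<=` Q)
    (hQM : (k_faces k Q #<= `I_M)%card) :
  let delta : R :=
    (omega R d / (4 * kappa R (d - 1))) `^ (2 / (d%:R - 1))
    * M%:R `^ (- (2 / (d%:R - 1))) in
  [/\ 0 < `|q| <= d%:R ->
        dual_deviation q (unit_ball R d) Q >=
        3 * (1 - expR (- 1)) / 4 * dual_volume_ball d `|q|
        * Num.min 1 (`|q| / 6 * delta),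
      d%:R < `|q| ->
        dual_deviation q (unit_ball R d) Q >=
        3 * (1 - expR (- 1)) / 4 * kappa R d
        * Num.min 1 (`|q| / 6 * delta)
    & q = 0 ->
        log_deviation (unit_ball R d) Q >= 1 / 8 * delta].
Proof.
case: d Q hd hk hQ hBQ hQM => [//|n] Q hd hk hQ hBQ hQM.
rewrite -[in _ - 1]natr1 addrK subn1 [n.+1.-1]/=.
have [vs [K [vsM vs1 K0 gaugeP]]] := polytope_radial hd hk hQ hBQ hQM.
have k0 := @kappa_gt0 R n; have k1 := @kappa_gt0 R n.+1.
have w0 : 0 < omega R n.+1 by rewrite mulr_gt0.
have M0 : 0 < M%:R :> R by rewrite ltr0n.
have [|||tau [tau0 tau2 taun dl2]] :=
  @delta_bounds R n M (omega R n.+1 / (4 * kappa R n)) => //.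
  (* The bound [A <= (n + 1) / 2] amounts to [kappaS_le]. *)
  rewrite divr_gt0 ?mulr_gt0//= ler_pdivrMr ?mulr_gt0//.
  have := ler_wpM2l (ler0n R n.+1) (@kappaS_le R n); rewrite /omega; lra.
move=> delta; rewrite -/delta in tau2 dl2.
have dl02 : 0 <= delta <= 2 by rewrite dl2 -tau2 exprn_ge0// ltW.
have dl1 : 0 < 1 + delta by case/andP: dl02; lra.
pose c := (Num.sqrt (1 + delta))^-1.
have c0 : 0 <= c by rewrite invr_ge0 sqrtr_ge0.
have cdl : (1 + delta) * c ^+ 2 = 1.
  by rewrite exprVn sqr_sqrtr ?ltW// mulfV// gt_eqF.
have caps : (sphere_measure R n.+1
    (unit_sphere R n.+1 `&` [set u | (c < gauge vs u)%R]) <= (1 / 4)%:E)%E.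
  apply: (le_trans (caps_measure vs1 c0 tau0 _)); first by rewrite tau2.
  rewrite lee_fin taun.
  (* The constant in [delta] is chosen so that the bound for one cap is [1 / (4 M)]. *)
  have -> : kappa R n * (omega R n.+1 / (4 * kappa R n) / M%:R) / omega R n.+1 =
      (4 * M%:R)^-1.
    by field; rewrite !gt_eqF.
  rewrite ler_pdivrMr ?mulr_gt0//.
  have -> : 1 / 4 * (4 * M%:R) = M%:R :> R by field.
  by rewrite ler_nat.
split=> hq.
- have /andP[_ qd] := hq.
  have := @dual_deviation_ge _ _ vs K Q K0 gaugeP c delta c0 dl02 cdl caps q.
  rewrite /c1 qd => /(_ (dual_volume_ball_ge0 _ _)).
  by apply: le_trans; rewrite le_eqVlt; apply/orP; left; apply/eqP; ring.
- have := @dual_deviation_ge _ _ vs K Q K0 gaugeP c delta c0 dl02 cdl caps q.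
  rewrite /c1 (lt_geF hq) => /(_ (ltW k1)).
  by apply: le_trans; rewrite le_eqVlt; apply/orP; left; apply/eqP; ring.
- have := log_deviation_ge K0 gaugeP c0 dl02 cdl caps hBQ.
  (* [1 / 8] is the proportion [3 / 4] of the sphere times the [1 / 6] of [ln_radial_ge]. *)
  by apply: le_trans; lra.
Qed.
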